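(* Let $k>1$ be an integer, consider an admissible figure (for this $k$) consisting of $n$ tiles, and let $G\le S_n$ be its puzzle group. Then: 1. If $k$ is even and $n\neq 6$, then $G=A_n$ if $k\equiv 0 \pmod 4$, and $G=S_n$ if $k\equiv 2\pmod 4$. 2. If $k$ is odd and $n\neq 12$, color the figure as a checkerboard in black and white, and suppose there are $m$ black tiles and $n-m$ white tiles (so $G$ may be regarded as a subgroup of $S_m\times S_{n-m}$, permuting the black tiles among themselves and the white tiles among themselves). Then $G=A_m\times A_{n-m}$ if $k\equiv 1,7\pmod 8$, and $G=\mathrm{Even}(S_m\times S_{n-m})$ if $k\equiv 3,5\pmod 8$, where $\mathrm{Even}(S_m\times S_{n-m})=(A_m\times A_{n-m})\cup\big((S_m\setminus A_m)\times(S_{n-m}\setminus A_{n-m})\big)$ is the set of all even permutations in $S_m\times S_{n-m}$. 3. If $n=6$, then under an appropriate labeling of the six tiles by the points of the projective line over $\mathbb{Z}_5$, $G=PGL_2(5)$ (acting by fractional linear transformations $z\mapsto \frac{az+b}{cz+d}$ with $a,b,c,d\in\mathbb{Z}_5$, $ad-bc\neq 0$), and $PGL_2(5)\cong S_5$. If $k=3$ and $n=12$, then $G\cong S_6$, and the restriction (projection) of $G$ to each of its two orbits is the full symmetric group $S_6$ on that orbit.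
   Context: Tiles are unit squares of the integer grid in the plane. For a fixed integer $k\ge 1$, an arrangement (figure) of tiles is called admissible if it can be formed by successively placing grid-aligned $k\times(k+1)$ and/or $(k+1)\times k$ rectangles of tiles such that each new rectangle overlaps the union of the previously placed rectangles in at least one tile when $k$ is even, and in at least two adjacent tiles when $k$ is odd. A move consists of rotating clockwise by $90^\circ$ the tiles in any $k\times k$ square block of tiles that is contained in the figure; each such move is a permutation of the $n$ tiles of the figure. The puzzle group $G$ of the figure is the subgroup of the symmetric group $S_n$ (on the set of tiles) generated by all such moves. $A_n$ denotes the alternating group. *)

(* Defs.v *)
From HB Require Import structures.
From mathcomp Require Import all_boot all_order all_fingroup all_solvable.
From mathcomp Require Import all_algebra finmap ring.

Set Implicit Arguments.
Unset Strict Implicit.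
Unset Printing Implicit Defensive.

Import GRing.Theory GroupScope.

Local Open Scope fset_scope.

(* A tile is given by the coordinates of its lower left corner; the first axis
   points to the right and the second one upwards. *)
Definition tile : Type := (int * int)%type.

(* The w x h rectangle (width w, height h) whose lower left tile is p. *)
Definition rect (p : tile) (w h : nat) : {fset tile} :=
  [fset ((p.1 + Posz (val ij.1))%R, (p.2 + Posz (val ij.2))%R)
     | ij : 'I_w * 'I_h].

Definition is_piece (k : nat) (R : {fset tile}) : Prop :=
  exists p : tile, R = rect p k k.+1 \/ R = rect p k.+1 k.

Definition adjacent (s t : tile) : bool :=
  (`|s.1 - t.1| + `|s.2 - t.2| == 1)%R.

Definition overlaps (k : nat) (R F : {fset tile}) : Prop :=
  if odd k then
    exists s t : tile, [/\ s \in R `&` F, t \in R `&` F & adjacent s t]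
  else exists s : tile, s \in R `&` F.

Inductive admissible (k : nat) : {fset tile} -> Prop :=
| admissible_piece R : is_piece k R -> admissible k R
| admissible_add F R : admissible k F -> is_piece k R -> overlaps k R F ->
    admissible k (R `|` F).

(* Clockwise quarter turn of the k x k block with lower left tile p: the offset
   (i, j) from p is sent to (j, k - 1 - i). *)
Definition rot (k : nat) (p t : tile) : tile :=
  if t \in rect p k k
  then ((p.1 + (t.2 - p.2))%R, (p.2 + (Posz k - 1 - (t.1 - p.1)))%R)
  else t.

(* The lower left tile of a block contained in F is itself a tile of F as soon
   as 0 < k, so blocks are indexed by tiles of F. *)
Definition is_move (k : nat) (F : {fset tile}) (s : {perm F}) : bool :=
  [exists p : F, (rect (val p) k k `<=` F) &&
     [forall t : F, val (s t) == rot k (val p) (val t)]].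

Definition puzzle_group (k : nat) (F : {fset tile}) : {group {perm F}} :=
  <<[set s : {perm F} | is_move k s]>>%G.

Definition black (F : {fset tile}) : {set F} :=
  [set t : F | (2 %| ((val t).1 + (val t).2)%R)%Z].

Definition white (F : {fset tile}) : {set F} := ~: black F.

Section PermutationsOfSubsets.

Variable T : finType.
Implicit Types A B : {set T}.

(* The alternating group on A, inside {perm T}. *)
Definition AltOn A : {set {perm T}} := perm.Sym A :&: 'Alt_T.

Canonical AltOn_group A := Eval hnf in [group of AltOn A].

(* Even(S_A x S_B), for disjoint A and B. *)
Definition EvenProd A B : {set {perm T}} := (perm.Sym A * perm.Sym B) :&: 'Alt_T.

Lemma in_AltOn A (s : {perm T}) :
  (s \in AltOn A) = (s \in perm.Sym A) && ~~ odd_perm s.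
Proof. by rewrite in_setI Alt_even. Qed.

Lemma EvenProdE A B :
  EvenProd A B = AltOn A * AltOn B
                 :|: (perm.Sym A :\: AltOn A) * (perm.Sym B :\: AltOn B).
Proof.
apply/setP=> s; rewrite in_setU in_setI Alt_even; apply/andP/orP.
  case=> /mulsgP[/= a b aA bB ->]; rewrite odd_permM => oab.
  case oa: (odd_perm a) oab; case ob: (odd_perm b) => // _; [right|left].
    by rewrite mem_mulg // in_setD in_AltOn ?oa ?ob andbF.
  by rewrite mem_mulg // in_AltOn ?oa ?ob andbT.
case=> /mulsgP[/= a b].
  rewrite (in_AltOn A a) (in_AltOn B b) => /andP[aA oa] /andP[bB ob] ->.
  by rewrite mem_mulg // odd_permM (negPf oa) (negPf ob).
case/setDP=> aA; rewrite (in_AltOn A a) aA negbK => oa.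
case/setDP=> bB; rewrite (in_AltOn B b) bB negbK => ob ->.
by rewrite mem_mulg // odd_permM oa ob.
Qed.

End PermutationsOfSubsets.

Section ProjectiveLine.

Variable K : finFieldType.

Local Open Scope ring_scope.

(* The projective line over K is [option K], with [None] the point at
   infinity. *)
Definition moebius (a b c d : K) (z : option K) : option K :=
  match z with
  | None => if c == 0 then None else Some (a / c)
  | Some x => if c * x + d == 0 then None else Some ((a * x + b) / (c * x + d))
  end.

Definition PGL2 : {set {perm option K}} :=
  [set s : {perm option K} | [exists a, exists b, exists c, exists d,
     (a * d - b * c != 0) && [forall z, s z == moebius a b c d z]]].

Lemma PGL2P (s : {perm option K}) :
  reflect (exists a b c d, a * d - b * c != 0 /\ s =1 moebius a b c d)
          (s \in PGL2).
Proof.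
rewrite inE; apply: (iffP existsP).
  case=> a /existsP[b /existsP[c /existsP[d /andP[D /forallP sE]]]].
  by exists a, b, c, d; split=> // z; apply/eqP.
case=> a [b [c [d [D sE]]]]; exists a; apply/existsP; exists b.
apply/existsP; exists c; apply/existsP; exists d; rewrite D /=.
by apply/forallP=> z; rewrite sE.
Qed.

Lemma moebiusM (a b c d a' b' c' d' : K) :
  a * d - b * c != 0 -> a' * d' - b' * c' != 0 ->
  moebius a' b' c' d' \o moebius a b c d =1
  moebius (a' * a + b' * c) (a' * b + b' * d)
          (c' * a + d' * c) (c' * b + d' * d).
Proof.
move=> D D' [x|] /=; last first.
  have [c0|cN0] := eqVneq c 0.
    have aN0 : a != 0.
      by apply: contraNneq D => a0; apply/eqP; rewrite a0 c0; ring.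
    rewrite c0 !mulr0 !addr0 mulf_eq0 (negPf aN0) orbF /=.
    by case: eqVneq => // c'0; congr Some; field; rewrite aN0 c'0.
  have E : c' * a + d' * c = (c' * (a / c) + d') * c by field.
  have E2 : a' * a + b' * c = (a' * (a / c) + b') * c by field.
  rewrite /= E E2 mulf_eq0 (negPf cN0) orbF.
  by case: eqVneq => // N0; congr Some; rewrite -mulf_div divff // mulr1.
have [w0|wN0] := eqVneq (c * x + d) 0.
  have uN0 : a * x + b != 0.
    apply: contraNneq D => u0.
    have [c0 | cN0] := eqVneq c 0.
    - have d0 : d = 0 by rewrite -w0 c0; ring.
      by rewrite c0 d0; apply/eqP; ring.
    have : c * (a * d - b * c) = 0.
      have -> : c * (a * d - b * c) =
        c * (a * (c * x + d) - c * (a * x + b)) by ring.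
      by rewrite w0 u0; ring.
    by move/eqP; rewrite mulf_eq0 (negPf cN0).
  have E : (c' * a + d' * c) * x + (c' * b + d' * d) = c' * (a * x + b).
    transitivity (c' * (a * x + b) + d' * (c * x + d)); first by ring.
    by rewrite w0; ring.
  have E2 : (a' * a + b' * c) * x + (a' * b + b' * d) = a' * (a * x + b).
    transitivity (a' * (a * x + b) + b' * (c * x + d)); first by ring.
    by rewrite w0; ring.
  rewrite E E2 mulf_eq0 (negPf uN0) orbF /=.
  by case: eqVneq => // N0; congr Some; field; rewrite uN0 N0.
set u := a * x + b; set w := c * x + d.
have E : (c' * a + d' * c) * x + (c' * b + d' * d) = (c' * (u / w) + d') * w.
  by rewrite /u /w; field.
have E2 : (a' * a + b' * c) * x + (a' * b + b' * d) = (a' * (u / w) + b') * w.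
  by rewrite /u /w; field.
rewrite E E2 mulf_eq0 (negPf wN0) orbF /=.
by case: eqVneq => // N0; congr Some; rewrite -mulf_div divff // mulr1.
Qed.

Lemma PGL2_group_set : group_set PGL2.
Proof.
apply/group_setP; split.
  apply/PGL2P; exists 1, 0, 0, 1; split; first by rewrite mulr1 mul0r subr0 oner_eq0.
  by case=> [x|]; rewrite perm1 /= ?mul0r ?add0r ?oner_eq0 ?divr1 ?mul1r ?addr0 ?eqxx.
move=> s t /PGL2P[a [b [c [d [D sE]]]]] /PGL2P[a' [b' [c' [d' [D' tE]]]]].
apply/PGL2P; do 4!eexists; split; last first.
  by move=> z; rewrite permM tE sE; apply: (moebiusM D D').
rewrite [X in X != 0](_ : _ = (a' * d' - b' * c') * (a * d - b * c)); last by ring.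
by rewrite mulf_neq0.
Qed.

Canonical PGL2_group := Group PGL2_group_set.

End ProjectiveLine.

(* Main.v *)
Require Import Defs.
From HB Require Import structures.
From mathcomp Require Import all_boot all_order all_fingroup all_solvable.
From mathcomp Require Import all_algebra finmap.
From mathcomp Require Import zify ring.

Import Order.TTheory GRing.Theory Num.Theory GroupScope.

Set Implicit Arguments.
Unset Strict Implicit.
Unset Printing Implicit Defensive.

(* A [k] x ([k]+1) rectangle carries two overlapping turns [a] and [b].  The
   element [c = (ab)^2] moves only tiles on three sides of the rectangle, since
   in its interior [ab] is a half turn; for [k >= 5] it has conjugates [c^x] whose
   support meets that of [c] in a single tile, so that [[~ c, c^x]] is a 3-cycle.
   A maximal set all of whose 3-cycles lie in the group is a block of
   imprimitivity.  Hence it is stable under any element of the group fixing one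
   of its points, and the above 3-cycle can be chosen to contain a tile fixed by
   [a] and a tile fixed by [b]; as [ab^-1] and [a^-1 b] act as diagonal
   translations, the maximal set is a whole colour class.  For [k = 4] a 3-cycle
   is a power of a word found by computer, and for [k = 2, 3], where one rectangle
   is not enough, so are 3-cycles in every union of two overlapping rectangles.
   Adding further rectangles to the figure enlarges the maximal set in the same
   way, and the parity of a turn is that of its number of 4-cycles.

   The rectangle with 6 tiles is identified with the projective line over F_5 by
   hand; [PGL2 'F_5] permutes by conjugation the five synthemes of a total.  For
   the rectangle with 12 tiles each colour class gives a map onto S_6, and these
   maps are injective because the tiles of one colour correspond, compatibly with
   the moves, to the six synthematic totals on the tiles of the other. *)

(** * Three-cycles *)

(** The moves permute a dependent type of tiles with integer coordinates, on which evaluation is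
    hopeless. Local arguments are therefore carried out on labels, pairs of natural numbers, and
    transported by [acts_as]; a lying rectangle is labelled as a quarter-turned standing one, so the
    same words serve both orientations. The merging of two sets with all their 3-cycles, once they
    share a point, stands in for primitivity and Jordan's theorem, and it can be executed, which
    makes the small cases checkable. For odd [k] a turn preserves the colours, and two adjacent
    common tiles supply a common tile of each colour; for even [k] a turn exchanges the colours
    inside its block, so all tiles form one class. The congruences come from counting: a turn has
    k^2/4 four-cycles for even [k] and (k^2-1)/8 in each colour for odd [k]. For [k] = 2, 3 the
    induction on the figure has to start from two distinct pieces, a single one being exceptional,
    and it needs a class too large for one piece. *)

Ltac distinct :=
  rewrite ?inE /= ?inE ?negb_or ?andbT /=;
  intros;
  repeat match goal with H : is_true (_ && _) |- _ => case/andP: H => ? ? end;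
  repeat (apply/andP; split);
  by [ | assumption | rewrite eq_sym; assumption].

Section ThreeCycles.
Variable T : finType.
Implicit Types (x y z u v w : T) (s g : {perm T}) (A B C : {set T}).
Implicit Type G : {group {perm T}}.

(** Products of permutations act from left to right, so this is the cycle x -> y -> z -> x. *)
Definition cyc3 x y z : {perm T} := tperm x y * tperm x z.

Lemma cyc3J x y z s : cyc3 x y z ^ s = cyc3 (s x) (s y) (s z).
Proof. by rewrite conjMg !tpermJ. Qed.

Lemma cyc3E x y z s : uniq [:: x; y; z] ->
  s x = y -> s y = z -> s z = x ->
  (forall t, t != x -> t != y -> t != z -> s t = t) -> s = cyc3 x y z.
Proof.
rewrite /= !inE negb_or andbT => /andP[/andP[xy xz] yz] sx sy sz st.
apply/permP=> t; rewrite permM.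
have [->|tx] := eqVneq t x; first by rewrite sx tpermL tpermD // eq_sym.
have [->|ty] := eqVneq t y; first by rewrite sy tpermR tpermL.
have [->|tz] := eqVneq t z; first by rewrite sz (tpermD xz yz) tpermR.
by rewrite st // !tpermD // eq_sym.
Qed.

Section Values.
Variables x y z : T.
Hypothesis U : uniq [:: x; y; z].

Lemma cyc3_1 : cyc3 x y z x = y.
Proof.
by case/and3P: U; rewrite !inE negb_or => /andP[xy xz] yz _; rewrite permM tpermL tpermD // eq_sym.
Qed.
Lemma cyc3_2 : cyc3 x y z y = z.
Proof. by rewrite permM tpermR tpermL. Qed.
Lemma cyc3_3 : cyc3 x y z z = x.
Proof.
by case/and3P: U; rewrite !inE negb_or => /andP[xy xz] yz _; rewrite permM (tpermD xz yz) tpermR.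
Qed.
Lemma cyc3_D t : t \notin [:: x; y; z] -> cyc3 x y z t = t.
Proof.
by rewrite !inE !negb_or => /and3P[tx ty tz]; rewrite permM !tpermD // eq_sym.
Qed.

Lemma cyc3_rot : cyc3 y z x = cyc3 x y z.
Proof.
apply/esym/cyc3E; rewrite ?cyc3_1 ?cyc3_2 ?cyc3_3 //.
  by (move: (U); distinct).
by move=> t ty tz tx; rewrite cyc3_D //; (move: (U); distinct).
Qed.

Lemma cyc3V : (cyc3 x y z)^-1 = cyc3 x z y.
Proof.
apply: cyc3E; last by move=> t *; apply: (canLR (permK _)); rewrite cyc3_D //; (move: (U); distinct).
- by (move: (U); distinct).
- by apply: (canLR (permK _)); rewrite cyc3_3.
- by apply: (canLR (permK _)); rewrite cyc3_2.
- by apply: (canLR (permK _)); rewrite cyc3_1.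
Qed.
End Values.

Section InGroup.
Variable G : {group {perm T}}.

Lemma cyc3_rotG x y z : uniq [:: x; y; z] -> cyc3 x y z \in G -> cyc3 y z x \in G.
Proof. by move/cyc3_rot=> ->. Qed.

Lemma cyc3_flipG x y z : uniq [:: x; y; z] -> cyc3 x y z \in G -> cyc3 x z y \in G.
Proof. by move=> U ?; rewrite -cyc3V // groupV. Qed.

(** Conjugation by [cyc3 x y z] fixes [u] and carries the edge from x, y to y, z and then to z, x,
    so [u] forms a 3-cycle with every edge of the triangle. *)
Lemma cyc3_edge x y z u : uniq [:: x; y; z; u] ->
  cyc3 x y z \in G -> cyc3 x y u \in G -> cyc3 x z u \in G.
Proof.
move=> U c1 c2.
have U3 : uniq [:: x; y; z] by (move: (U); distinct).
have c3 : cyc3 (cyc3 x y z x) (cyc3 x y z y) (cyc3 x y z u) \in G.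
  by rewrite -cyc3J groupJ.
have c4 : cyc3 y z u \in G.
  by move: c3; rewrite cyc3_1 // cyc3_2 cyc3_D //; (move: (U); distinct).
have : cyc3 (cyc3 x y z y) (cyc3 x y z z) (cyc3 x y z u) \in G.
  by rewrite -cyc3J groupJ.
rewrite cyc3_2 cyc3_3 // cyc3_D; last by (move: (U); distinct).
move=> c5; have U5 : uniq [:: z; x; u] by (move: (U); distinct).
move/(cyc3_rotG U5)/cyc3_flipG: c5; apply; by (move: (U); distinct).
Qed.

(** Vacuous on fewer than three points, which is why cardinalities above two accompany it wherever
    sets are merged. *)
Definition has_cyc3s A : bool :=
  [forall x in A, forall y in A, forall z in A,
     uniq [:: x; y; z] ==> (cyc3 x y z \in G)].

Lemma has_cyc3sP A :
  reflect (forall x y z, x \in A -> y \in A -> z \in A ->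
             uniq [:: x; y; z] -> cyc3 x y z \in G)
          (has_cyc3s A).
Proof.
apply: (iffP forall_inP) => [H x y z xA yA zA|H x xA].
  by move: (H x xA) => /forall_inP/(_ y yA)/forall_inP/(_ z zA)/implyP.
by apply/forall_inP=> y yA; apply/forall_inP=> z zA; apply/implyP; apply: H.
Qed.

(** Two uses of [cyc3_edge]: along the edge x, y for all triples through [x], then along the edge p,
    x for a triple p, q, r. *)
Lemma has_cyc3s_star A x y : x != y -> x \in A -> y \in A ->
  (forall z, z \in A -> uniq [:: x; y; z] -> cyc3 x y z \in G) -> has_cyc3s A.
Proof.
move=> xy xA yA H.
have S q r : q \in A -> r \in A -> uniq [:: x; q; r] -> cyc3 x q r \in G.
  move=> qA rA U.
  have [qy|qy] := eqVneq q y; first by subst q; apply: H.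
  have [ry|ry] := eqVneq r y.
    subst r; have U' : uniq [:: x; y; q] by move: U; distinct.
    exact: (cyc3_flipG U' (H _ qA U')).
  by apply: (@cyc3_edge x y); rewrite ?H //; move: U xy; distinct.
apply/has_cyc3sP=> p q r pA qA rA U.
have [px|px] := eqVneq p x; first by subst p; apply: S.
have [qx|qx] := eqVneq q x.
  have U' : uniq [:: q; r; p] by move: U; distinct.
  by rewrite -(cyc3_rot U) {1}qx; apply: S => //; rewrite -qx.
have [rx|rx] := eqVneq r x.
  have U' : uniq [:: r; p; q] by move: U; distinct.
  by rewrite (cyc3_rot U') {1}rx; apply: S => //; rewrite -rx.
have Sx u v : u \in A -> v \in A -> uniq [:: u; x; v] -> cyc3 u x v \in G.
  by move=> uA vA U'; rewrite -(cyc3_rot U') S //; move: U'; distinct.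
by apply: (@cyc3_edge p x); rewrite ?Sx //; move: U; distinct.
Qed.

Lemma has_cyc3s_set3 x y z : uniq [:: x; y; z] -> cyc3 x y z \in G ->
  has_cyc3s [set x; y; z].
Proof.
move=> U c; apply: (@has_cyc3s_star _ x y); rewrite ?inE ?eqxx ?orbT //.
  by move: U; distinct.
move=> t; rewrite !inE -orbA => /or3P[]/eqP-> //=; rewrite !inE ?eqxx ?orbT //.
by rewrite andbF.
Qed.

Lemma has_cyc3sJ A g : g \in G -> has_cyc3s A -> has_cyc3s (g @: A).
Proof.
move=> gG /has_cyc3sP H; apply/has_cyc3sP => x0 y0 z0 /imsetP[x xA ->].
move=> /imsetP[y yA ->] /imsetP[z zA ->] U.
rewrite -cyc3J groupJ // H //.
by move: U; rewrite (map_inj_uniq perm_inj [:: x; y; z]).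
Qed.

(** Let [x] be common, [y] in [A] and [z] in [B] only. In the generic case, conjugating a 3-cycle x
    z w of [B] by a 3-cycle x y u of [A] gives y z w, which shares the edge z, w with x z w; so x,
    y, z form a 3-cycle of the group. The coincidences w = y and w = u are easier. *)
Lemma has_cyc3sU A B : (2 < #|A|)%N -> (2 < #|B|)%N -> A :&: B != set0 ->
  has_cyc3s A -> has_cyc3s B -> has_cyc3s (A :|: B).
Proof.
move=> A3 B3 /set0Pn[x /setIP[xA xB]] /has_cyc3sP HA /has_cyc3sP HB.
have pick2 (C : {set T}) u v : (2 < #|C|)%N -> exists2 w, w \in C & (w != u) && (w != v).
  move=> C3; have : C :\: [set u; v] != set0.
    rewrite setD_eq0; apply: contraL C3 => /subset_leq_card CS.
    by rewrite -leqNgt (leq_trans CS) // cards2; case: eqP.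
  by case/set0Pn=> w; rewrite !inE negb_or => /andP[? wC]; exists w.
have [y yA /andP[yx _]] := pick2 A x x A3.
apply: (@has_cyc3s_star _ x y); rewrite ?inE ?xA ?yA ?(eq_sym x y) //.
move=> z; rewrite inE; have [zA _|zA /= zB] := boolP (z \in A); first exact: HA.
move=> U.
have [w wB /andP[wx wz]] := pick2 B x z B3.
have [wy|wy] := eqVneq w y.
  by apply: HB => //; rewrite -wy.
have [u uA /andP[ux uy]] := pick2 A x y A3.
have uz : u != z by apply: contraNneq zA => <-.
have c1 : cyc3 x y u \in G by apply: HA => //; move: U; distinct.
have c2 : cyc3 x z w \in G by apply: HB => //; move: U; distinct.
have [wu|wu] := eqVneq w u.
  apply: (@cyc3_edge x u); first by move: U; distinct.
    by apply: (@cyc3_flipG x y u) => //; move: U; distinct.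
  by subst w; apply: (@cyc3_flipG x z u) => //; move: U; distinct.
have c3 : cyc3 y z w \in G.
  have := groupJ c2 c1; rewrite cyc3J cyc3_1 ?cyc3_D //; move: U; distinct.
apply: cyc3_flipG; first by move: U; distinct.
rewrite -cyc3_rot; last by move: U; distinct.
apply: (@cyc3_edge z w).
- by move: U; distinct.
- by rewrite cyc3_rot; [|move: U; distinct].
by rewrite cyc3_rot; [|move: U; distinct].
Qed.

Lemma max_has_cyc3s A : (2 < #|A|)%N -> has_cyc3s A ->
  exists C, [/\ A \subset C, has_cyc3s C &
    forall g, g \in G -> g @: C :&: C != set0 -> g @: C = C].
Proof.
move=> A3 HA.
have [C /maxsetP[HC maxC] AC] := maxset_exists (P := has_cyc3s) HA.
exists C; split=> // g gG gC.
have C3 : (2 < #|C|)%N by apply: leq_trans A3 (subset_leq_card AC).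
have gC3 : #|g @: C| = #|C| by rewrite card_imset //; apply: perm_inj.
have := maxC (g @: C :|: C).
rewrite has_cyc3sU ?gC3 ?has_cyc3sJ // subsetUr => /(_ isT isT) E.
by apply/eqP; rewrite eqEcard gC3 leqnn andbT -{2}E subsetUl.
Qed.

Lemma has_cyc3sS A B : A \subset B -> has_cyc3s B -> has_cyc3s A.
Proof.
move/subsetP=> AB /has_cyc3sP H; apply/has_cyc3sP=> x y z xA yA zA.
by apply: H; apply: AB.
Qed.

(** Induction on the support: if [s] sends x to y, a 3-cycle on moved points that sends y back to x
    makes x fixed and moves nothing new. Its third point exists because [s] would otherwise be a
    transposition, which is odd. *)
Lemma AltOn_sub A : has_cyc3s A -> AltOn A \subset G.
Proof.
move/has_cyc3sP=> H; apply/subsetP=> s.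
have [n] := ubnP #|[set x | s x != x]|; elim: n s => // n IH s.
rewrite ltnS => sn; rewrite in_AltOn inE => /andP[sA so].
have [S0|/set0Pn[x]] := eqVneq [set x | s x != x] set0.
  suff -> : s = 1 by [].
  apply/permP=> x; rewrite perm1; apply/eqP.
  by have := in_set0 x; rewrite -S0 inE => /negbFE.
rewrite inE => sx.
have memA y : s y != y -> y \in A by move=> ?; apply: (subsetP sA); rewrite inE.
set y := s x in sx.
have sy : s y != y by apply: contra_neq sx => /perm_inj.
have [z sz /andP[zx zy]] : exists2 z, s z != z & (z != x) && (z != y).
  apply/exists_inP; apply: contraR so => /exists_inPn H1.
  have H2 z : z != x -> z != y -> s z = z.
    move=> zx zy; apply/eqP; apply: contraT => sz.
    by have := H1 z sz; rewrite zx zy.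
  suff -> : s = tperm x y by rewrite odd_tperm eq_sym.
  apply/permP=> t; have [->|tx] := eqVneq t x; first by rewrite tpermL.
  have [->|ty] := eqVneq t y; last by rewrite tpermD 1?eq_sym ?H2.
  rewrite tpermR; apply/eqP; apply: contraT => syx.
  by case/eqP: (sy); apply: perm_inj; apply: H2.
have U : uniq [:: y; x; z] by move: (memA _ sx); distinct.
have c : cyc3 y x z \in G by rewrite H ?memA.
rewrite -(groupMr _ c); apply: IH; last first.
  rewrite in_AltOn odd_permM (negPf so) odd_permM !odd_tperm.
  rewrite (_ : _ (+) _ = false); last by move: U; rewrite /= !inE; case: eqP; case: eqP.
  rewrite andbT; apply: groupM; rewrite ?inE //.
  by apply/subsetP=> t; rewrite inE; apply: contraR => tA;
    rewrite cyc3_D // !inE; apply: contra tA; case/or3P=> /eqP->; exact: memA.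
apply: leq_trans sn; apply: proper_card; apply/properP; split; last first.
  by exists x; rewrite !inE ?sx // permM cyc3_1 // eqxx.
apply/subsetP=> t; rewrite !inE permM; apply: contra => /eqP st.
rewrite st cyc3_D //; rewrite !inE; apply/negP; case/or3P=> /eqP E.
- by move: sy; rewrite -E st eqxx.
- by move: sx; rewrite /y -E st eqxx.
by move: sz; rewrite -E st eqxx.
Qed.
End InGroup.
End ThreeCycles.

(** * Tiles and blocks *)

Local Open Scope nat_scope.

(** The point [c z] is moved by [c] and differs from [z], so [d] fixes it, and likewise [c] fixes
    [d z]; elsewhere at most one of [c], [d] acts and the commutator cancels. *)
Lemma comm_cyc3 (T : finType) (c d : {perm T}) (z : T) :
  c z != z -> d z != z -> (forall t, c t != t -> d t != t -> t = z) ->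
  [~ c, d] = cyc3 z (d z) (c z) /\ uniq [:: z; d z; c z].
Proof.
move=> cz dz H.
have ccz : c (c z) != c z by apply: contra_neq cz => /perm_inj.
have ddz : d (d z) != d z by apply: contra_neq dz => /perm_inj.
have dcz : d (c z) = c z.
  by apply/eqP; apply: contraNT cz => /(H _ ccz)->.
have cdz : c (d z) = d z.
  by apply/eqP; apply: contraNT dz => h; rewrite (H _ h ddz).
have cfix t : t != z -> d t != t -> c t = t.
  by move=> tz dt; apply/eqP; apply: contraNT tz => ct; rewrite (H t).
have dfix t : t != z -> c t != t -> d t = t.
  by move=> tz ct; apply/eqP; apply: contraNT tz => dt; rewrite (H t).
(* The commutator applies c^-1, d^-1, c, d in this order. *)
have E t u w : c u = t -> d w = u -> [~ c, d] t = d (c w).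
  by move=> <- <-; rewrite commgEl conjgE !permM !permK.
have pre (s : {perm T}) t : {u | s u = t} by exists (s^-1 t); rewrite permKV.
have U : uniq [:: z; d z; c z].
  rewrite /= !inE negb_or !(eq_sym z) dz cz /= andbT.
  by apply: contra_neq dz => h; apply: (@perm_inj _ d); rewrite h.
split=> //; apply: cyc3E => //.
- have [u cu] := pre c z; have uz : u != z by apply: contraNneq cz => h; rewrite -{1}h cu.
  by rewrite (E _ _ _ cu (dfix u uz _)) cu // eq_sym.
- by rewrite (E _ _ _ cdz erefl).
- have [w dw] := pre d z; have wz : w != z by apply: contraNneq dz => h; rewrite -{1}h dw.
  by rewrite (E _ _ _ erefl dw) cfix ?dw // eq_sym.
move=> t tz tdz tcz.
have [ct|ct] := eqVneq (c t) t.
  have [w dw] := pre d t; rewrite (E _ _ _ ct dw).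
  have [wt|wt] := eqVneq w t; first by rewrite wt ct -{1}wt.
  rewrite cfix ?dw //; last by rewrite eq_sym.
  by apply: contraNneq tdz => <-; rewrite dw.
have [u cu] := pre c t.
have uz : u != z by apply: contraNneq tcz => <-; rewrite cu.
rewrite (E _ _ _ cu (dfix u uz _)) ?cu ?dfix //.
by apply: contraNneq ct => h; rewrite {1}h cu.
Qed.

Definition shift (p : tile) (u : nat * nat) : tile :=
  (p.1 + Posz u.1, p.2 + Posz u.2)%R.

Lemma mem_rect p w h t :
  (t \in rect p w h) =
  ((p.1 <= t.1) && (t.1 < p.1 + Posz w) && ((p.2 <= t.2) && (t.2 < p.2 + Posz h)))%R.
Proof.
apply/imfsetP/idP => /= [[[i j] _ ->]|].
  by have := ltn_ord i; have := ltn_ord j; move=> /=; lia.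
case: t => x y /= H.
have hi : `|x - p.1|%N < w by lia.
have hj : `|y - p.2|%N < h by lia.
exists (Ordinal hi, Ordinal hj) => //=; congr (_, _); lia.
Qed.

Lemma shift_inj p : injective (shift p).
Proof. by move=> [a b] [c d] [] h1 h2; congr (_, _); lia. Qed.

Definition in_block (k : nat) (q t : nat * nat) : bool :=
  (q.1 <= t.1 < q.1 + k) && (q.2 <= t.2 < q.2 + k).

(** The turn [rot] on natural offsets; inside the block the truncated subtractions are exact. *)
Definition rotn (k : nat) (q t : nat * nat) : nat * nat :=
  if in_block k q t then (q.1 + (t.2 - q.2), q.2 + (k.-1 - (t.1 - q.1))) else t.

Lemma rot_shift k p q t : Defs.rot k (shift p q) (shift p t) = shift p (rotn k q t).
Proof.
rewrite /Defs.rot /rotn mem_rect /in_block.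
case: q t => [qx qy] [x y] /=.
have -> : ((p.1 + Posz qx <= p.1 + Posz x) && (p.1 + Posz x < p.1 + Posz qx + Posz k) &&
   ((p.2 + Posz qy <= p.2 + Posz y) && (p.2 + Posz y < p.2 + Posz qy + Posz k)) =
   (qx <= x < qx + k)%N && (qy <= y < qy + k)%N)%R by lia.
case: ifP => // H; rewrite /shift /=; congr (_, _); lia.
Qed.

Lemma rot_block k p t : t \in rect p k k -> Defs.rot k p t \in rect p k k.
Proof. rewrite /Defs.rot => tp; rewrite tp; move: tp; rewrite !mem_rect /=; lia. Qed.

Lemma rot_inj k p : injective (Defs.rot k p).
Proof.
move=> s t; have [sp|sp] := boolP (s \in rect p k k); have [tp|tp] := boolP (t \in rect p k k).
- rewrite /Defs.rot sp tp; case: s sp => a b; case: t tp => c d; rewrite !mem_rect /= => ? ? [] ? ?.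
  congr (_, _); lia.
- move=> E; have := rot_block sp; rewrite E.
  by rewrite [Defs.rot k p t]/Defs.rot (negPf tp) => h; rewrite h in tp.
- move=> E; have := rot_block tp; rewrite -E.
  by rewrite [Defs.rot k p s]/Defs.rot (negPf sp) => h; rewrite h in sp.
- by rewrite /Defs.rot (negPf sp) (negPf tp).
Qed.

(** * Permutations acting on labels *)

Lemma move_exists k (F : {fset tile}) p : 0 < k -> (rect p k k `<=` F)%fset ->
  exists2 s, s \in puzzle_group k F & forall t : F, val (s t) = Defs.rot k p (val t).
Proof.
move=> k0 /fsubsetP pF.
have rF (t : F) : Defs.rot k p (val t) \in F.
  have [tp|tp] := boolP (val t \in rect p k k); first by apply/pF/rot_block.
  by rewrite /Defs.rot (negPf tp) fsvalP.
have inj : injective (fun t : F => [` rF t]%fset).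
  by move=> s t /(congr1 val) /= /rot_inj /val_inj.
exists (perm inj); last by move=> t; rewrite permE.
apply: mem_gen; rewrite inE; apply/existsP.
have pp : p \in F by apply: pF; rewrite mem_rect !lexx !ltrDl; lia.
exists [` pp]%fset; rewrite /=; apply/andP; split; first exact/fsubsetP.
by apply/forallP=> t; rewrite permE.
Qed.

Section Labelled.
Variables (T : finType) (D : eqType) (e : D -> T).

(** The second clause makes [s] fix every point without a label, so that the map on labels
    determines [s] completely. *)
Definition acts_as (L : {pred D}) (s : {perm T}) (f : D -> D) : Prop :=
  (forall u, u \in L -> f u \in L /\ s (e u) = e (f u)) /\
  (forall t, (forall u, u \in L -> t <> e u) -> s t = t).

Variable L : {pred D}.

Lemma acts_as1 : acts_as L 1%g id.
Proof. by split=> [u uL|t _]; rewrite perm1. Qed.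

Lemma acts_asM s s' f f' : acts_as L s f -> acts_as L s' f' ->
  acts_as L (s * s')%g (f' \o f).
Proof.
move=> [H1 H2] [H1' H2']; split=> [u uL|t tL]; rewrite permM; last by rewrite H2 ?H2'.
by have [fuL ->] := H1 u uL; have [? ->] := H1' _ fuL.
Qed.

Lemma acts_asX s f n : acts_as L s f -> acts_as L (s ^+ n)%g (iter n f).
Proof.
move=> sf; elim: n => [|n IH]; first by rewrite expg0; apply: acts_as1.
by rewrite expgSr; apply: acts_asM.
Qed.

Lemma acts_as_eq s f f' : {in L, f =1 f'} -> acts_as L s f -> acts_as L s f'.
Proof. by move=> E [H1 H2]; split=> // u uL; rewrite -E //; apply: H1. Qed.

Lemma acts_asV s f f' : {in L, forall u, f' u \in L /\ f (f' u) = u} ->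
  acts_as L s f -> acts_as L s^-1%g f'.
Proof.
move=> E [H1 H2]; split=> [u uL|t tL]; last by apply: (canLR (permK _)); rewrite H2.
have [ok fK] := E u uL; split=> //; apply: (canLR (permK _)).
by have [_ ->] := H1 _ ok; rewrite fK.
Qed.

End Labelled.

(** * 3-cycles and transpositions certified by evaluating words *)

Section Search.
Variable D : eqType.
Implicit Types (L S : seq D) (fs : seq (D -> D)).

Definition word fs (w : seq nat) : D -> D :=
  foldr (fun i h => h \o nth id fs i) id w.

Definition moved L (f : D -> D) : seq D := [seq u <- L | f u != u].

Lemma mem_moved L f u : (u \in moved L f) = (f u != u) && (u \in L).
Proof. exact: mem_filter. Qed.

(** One executable pass of the merging argument: an image of [S] that meets [S] is absorbed, as
    [has_cyc3sU] permits. *)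
Definition grow fs S : seq D :=
  foldl (fun S f => let S' := map f S in
                    if has (mem S) S' then undup (S' ++ S) else S) S fs.

Definition spreads fs L (f : D -> D) n (A : seq D) : bool :=
  if moved L f is [:: x; _; _] then
    let y := f x in let z := f y in
    [&& uniq [:: x; y; z], f z == x & all (mem (iter n (grow fs) [:: x; y; z])) A]
  else false.

(* The [let] makes [vm_compute] tabulate [f] once. *)
Definition memo L (f : D -> D) : D -> D :=
  let t := map f L in fun u => nth u t (index u L).

Lemma memoE L f : {in L, memo L f =1 f}.
Proof.
by move=> u uL; rewrite /memo (nth_map u) ?index_mem // nth_index.
Qed.

(** The exponent is the product of [cs]; tabulating after each factor keeps the cost near their
    sum. *)
Definition power_word L fs w (cs : seq nat) : D -> D :=
  foldl (fun g c => memo L (iter c g)) (memo L (word fs w)) cs.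

Variables (T : finType) (e : D -> T) (G : {group {perm T}}).
Variables (L : seq D) (fs : seq (D -> D)).
Hypothesis e_inj : {in L &, injective e}.
Hypothesis fsG : forall i, exists2 s, s \in G & acts_as e (mem L) s (nth id fs i).

Lemma word_acts w : exists2 s, s \in G & acts_as e (mem L) s (word fs w).
Proof.
elim: w => [|i w [s sG sw]]; first by exists 1%g; rewrite ?group1 //; apply: acts_as1.
have [s' s'G s'i] := fsG i.
by exists (s' * s)%g; rewrite ?groupM //; apply: acts_asM.
Qed.

Definition grown S : Prop :=
  [/\ {subset S <= L}, has_cyc3s G [set:: map e S] & 2 < #|[set:: map e S]|].

Lemma grow_sound S : grown S -> grown (grow fs S).
Proof.
have aux gs S' : (forall i, exists2 s, s \in G & acts_as e (mem L) s (nth id gs i)) ->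
  grown S' -> grown (grow gs S').
  elim: gs S' => // f gs IH S' gsG S'ok; apply: IH => [i|]; first exact: (gsG i.+1).
  have [s sG [s1 s2]] := gsG 0; case: S'ok => S'L S'c S'3 /=.
  case: ifP => [meet|_]; last by split.
  have E1 : [set:: map e (map f S')] = s @: [set:: map e S'].
    apply/setP=> t; rewrite inE -map_comp; apply/mapP/imsetP => [[u uS ->]|[t']].
      exists (e u); first by rewrite inE map_f.
      by have [_ ->] := s1 u (S'L u uS).
    rewrite inE => /mapP[u uS ->] ->; exists u => //.
    by have [_ ->] := s1 u (S'L u uS).
  have E2 : [set:: map e (undup (map f S' ++ S'))] = s @: [set:: map e S'] :|: [set:: map e S'].
    apply/setP=> t; rewrite -E1 !inE; apply/mapP/orP => [[u]|].
      by rewrite mem_undup mem_cat => /orP[] uS ->; [left|right]; apply: map_f.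
    by case=> /mapP[u uS ->]; exists u; rewrite // mem_undup mem_cat uS ?orbT.
  split.
  - move=> u; rewrite mem_undup mem_cat => /orP[/mapP[v vS ->]|]; last exact: S'L.
    by have [] := s1 v (S'L v vS).
  - rewrite E2 has_cyc3sU ?has_cyc3sJ //.
      by rewrite card_imset //; apply: perm_inj.
    apply/set0Pn; have/hasP[v /mapP[u uS ->] fuS] := meet.
    exists (e (f u)); rewrite inE -E1 !inE -map_comp.
    by rewrite (map_f (e \o f) uS) map_f.
  - by rewrite E2 (leq_trans S'3) // subset_leq_card // subsetUr.
by apply: aux.
Qed.

Lemma spreads_sound f n A :
  (exists2 s, s \in G & acts_as e (mem L) s f) -> spreads fs L f n A ->
  has_cyc3s G [set:: map e A].
Proof.
case=> s sG [s1 s2]; rewrite /spreads.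
case E: (moved L f) => [//|x [//|y' [//|z' []//]]] /and3P[U /eqP fz /allP HA].
set y := f x in U fz HA; set z := f y in U fz HA.
have : x \in moved L f by rewrite E inE eqxx.
rewrite mem_moved => /andP[_ xL].
have [yL sx] := s1 x xL; have [zL sy] := s1 y yL; have [_ sz] := s1 z zL.
have sub : {subset [:: x; y; z] <= moved L f}.
  move=> u; rewrite !inE mem_moved => /or3P[] /eqP->; rewrite ?xL ?yL ?zL andbT -/y -/z ?fz;
    by move: U; distinct.
(* [f] moves exactly three labels and x, y, z are distinct moved ones, so they are all of them. *)
have [_ mE] := uniq_min_size U sub (eq_leq (congr1 size E)).
have Ue : uniq [:: e x; e y; e z].
  rewrite (map_inj_in_uniq (f := e) (s := [:: x; y; z])) //.
  by move=> u v uS vS; apply: e_inj; [move: uS|move: vS] => /sub; rewrite mem_moved => /andP[].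
have c : s = cyc3 (e x) (e y) (e z).
  apply: cyc3E; rewrite ?sx ?sy ?sz ?fz // => t tx ty tz.
  have [/mapP[u uL tE]|tL] := boolP (t \in map e L); last first.
    by apply: s2 => u uL tE; case/mapP: tL; exists u.
  have [_ su] := s1 u uL; rewrite tE su; congr e; apply/eqP; apply: contraT => fu.
  have : u \in moved L f by rewrite mem_moved fu.
  rewrite -mE !inE => /or3P[] /eqP uE; subst u.
  - by rewrite tE eqxx in tx.
  - by rewrite tE eqxx in ty.
  - by rewrite tE eqxx in tz.
have S3 : [set:: map e [:: x; y; z]] = [set e x; e y; e z].
  by apply/setP=> t; rewrite !inE orbA.
have G0 : grown [:: x; y; z].
  split; first by move=> u /sub; rewrite mem_moved => /andP[].
    by rewrite S3 has_cyc3s_set3 // -c.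
  by rewrite cardsE; move/card_uniqP: Ue => ->.
have [_ + _] : grown (iter n (grow fs) [:: x; y; z]).
  by elim: (n) => //= m; apply: grow_sound.
apply: has_cyc3sS; apply/subsetP=> t; rewrite !inE => /mapP[u uA ->].
by apply: map_f; apply: HA.
Qed.

Lemma power_word_acts w cs :
  exists2 s, s \in G & acts_as e (mem L) s (power_word L fs w cs).
Proof.
have memo_acts s f : acts_as e (mem L) s f -> acts_as e (mem L) s (memo L f).
  by apply: acts_as_eq => u uL; rewrite memoE.
have [s sG sw] := word_acts w; have {sw} := memo_acts _ _ sw.
rewrite /power_word; elim: cs s (memo _ _) sG => [|c cs IH] s g sG sg /=; first by exists s.
by apply: (IH (s ^+ c)%g); rewrite ?groupX //; apply/memo_acts/acts_asX.
Qed.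

Lemma spreads_word_sound w cs n A : spreads fs L (power_word L fs w cs) n A ->
  has_cyc3s G [set:: map e A].
Proof. by apply: spreads_sound; apply: power_word_acts. Qed.

Definition swaps (f : D -> D) : bool :=
  if moved L f is [:: x; y] then (f x == y) && (f y == x) else false.

Lemma swaps_tperm s f : acts_as e (mem L) s f -> swaps f ->
  exists x y, [/\ x \in L, y \in L, x != y & s = tperm (e x) (e y)].
Proof.
case=> s1 s2; rewrite /swaps.
case E: (moved L f) => [//|x [//|y []//]] /andP[/eqP fx /eqP fy].
have mv u : (u \in moved L f) = (u == x) || (u == y) by rewrite E !inE.
have /andP[fxx xL] : (f x != x) && (x \in L) by rewrite -mem_moved mv eqxx.
have /andP[_ yL] : (f y != y) && (y \in L) by rewrite -mem_moved mv eqxx orbT.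
exists x, y; split=> //; first by rewrite -fx eq_sym.
have [_ sx] := s1 x xL; have [_ sy] := s1 y yL.
apply/permP=> t; have [->|tx] := eqVneq t (e x); first by rewrite tpermL sx fx.
have [->|ty] := eqVneq t (e y); first by rewrite tpermR sy fy.
rewrite tpermD 1?eq_sym //.
have [/mapP[u uL tE]|tL] := boolP (t \in map e L); last first.
  by apply: s2 => u uL tE; case/mapP: tL; exists u.
have [_ su] := s1 u uL; rewrite tE su; congr e; apply/eqP; apply: contraT => fu.
have : u \in moved L f by rewrite mem_moved fu.
by rewrite mv => /orP[] /eqP uE; rewrite tE uE eqxx in tx ty.
Qed.

(** The alternating group and one transposition; this yields the full symmetric groups on five and
    six points. *)
Lemma Sym_sub w cs w' cs' n : spreads fs L (power_word L fs w cs) n L ->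
  swaps (power_word L fs w' cs') -> perm.Sym [set:: map e L] \subset G.
Proof.
move=> /spreads_word_sound /AltOn_sub AG sw.
have [s sG sE] := power_word_acts w' cs'.
have [x [y [xL yL xy sxy]]] := swaps_tperm sE sw.
have os : odd_perm s.
  by rewrite sxy odd_tperm; apply: contra_neq xy; apply: e_inj.
have sS : s \in perm.Sym [set:: map e L].
  rewrite inE sxy; apply/subsetP=> t; rewrite !inE.
  by case: tpermP => [->|->|_ _]; rewrite ?eqxx ?map_f.
apply/subsetP=> g gS.
have [og|og] := boolP (odd_perm g); last by apply: (subsetP AG); rewrite in_AltOn gS.
rewrite -(groupMr _ sG); apply: (subsetP AG).
by rewrite in_AltOn groupM //= odd_permM og os.
Qed.

End Search.

(** * Framed pieces *)

(** True on the white tiles. *)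
Definition colour (t : tile) : bool := ~~ (2 %| (t.1 + t.2)%R)%Z.

Definition box (k : nat) : seq (nat * nat) := allpairs pair (iota 0 k) (iota 0 k.+1).

Lemma mem_box k u : (u \in box k) = (u.1 < k) && (u.2 <= k).
Proof.
apply/allpairsP/idP => [[[i j] [+ + ->]]|/andP[u1 u2]].
  by rewrite !mem_iota /=; lia.
by exists u; rewrite !mem_iota /= !add0n u1 ltnS u2 -surjective_pairing.
Qed.

Lemma colour_shift p u : colour (shift p u) = colour p (+) odd (u.1 + u.2).
Proof. rewrite /colour /shift /=; lia. Qed.

(** The lying piece arises from the standing one by a clockwise quarter turn; unlike a reflection,
    this keeps clockwise turns clockwise. *)
Definition frame (v : bool) k (p : tile) (u : nat * nat) : tile :=
  if v then shift p u else shift p (u.2, k.-1 - u.1).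

Lemma frame_rot v k p j u : u \in box k -> j < 2 ->
  rotn k (0, j) u \in box k /\
  Defs.rot k (if v then shift p (0, j) else shift p (j, 0)) (frame v k p u)
    = frame v k p (rotn k (0, j) u).
Proof.
rewrite !mem_box; case: u => x y /= /andP[x1 y1] j2.
split; first by rewrite /rotn /in_block /=; case: ifP => /=; lia.
case: v; first exact: rot_shift.
rewrite /frame rot_shift /= /rotn /in_block /=.
do 2!case: ifP; move=> /= *; rewrite /shift /=; try lia; congr (_, _); lia.
Qed.

Lemma mem_frame v k p t :
  t \in (if v then rect p k k.+1 else rect p k.+1 k) <->
  exists2 u, u \in box k & t = frame v k p u.
Proof.
split; last first.
  by case=> [[x y]]; rewrite mem_box; case: v => /= H ->; rewrite mem_rect /=; lia.
case: t => x y; case: v; rewrite mem_rect /= => H.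
  exists (`|x - p.1|%N, `|y - p.2|%N); rewrite ?mem_box /=; first lia.
  by rewrite /frame /shift /=; congr (_, _); lia.
exists (k.-1 - `|y - p.2|%N, `|x - p.1|%N); rewrite ?mem_box /=; first lia.
by rewrite /frame /shift /=; congr (_, _); lia.
Qed.

Lemma frame_inj v k p : {in box k &, injective (frame v k p)}.
Proof.
move=> [a b] [c d]; rewrite !mem_box /frame /shift /=; case: v => ? ? [] ? ?; congr (_, _); lia.
Qed.

(** The last conclusion lists all moves inside a piece; it serves to compute the group when the
    figure is a single piece. *)
Lemma piece_frame_moves k (F R : {fset tile}) :
  0 < k -> is_piece k R -> (R `<=` F)%fset ->
  exists (e : nat * nat -> F) (c : bool) (a b : {perm F}),
  [/\ {in box k &, injective e},
      {in box k, forall u, colour (val (e u)) = c (+) odd (u.1 + u.2)},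
      forall t : F, val t \in R <-> exists2 u, u \in box k & t = e u,
      [/\ a \in puzzle_group k F, b \in puzzle_group k F,
          acts_as e (mem (box k)) a (rotn k (0, 0)) &
          acts_as e (mem (box k)) b (rotn k (0, 1))]
    & forall p (s : {perm F}), (rect p k k `<=` R)%fset ->
        (forall t : F, val (s t) = Defs.rot k p (val t)) -> s = a \/ s = b].
Proof.
move=> k0 [p Rp] RF.
have {Rp}[v RE] : exists v : bool, R = if v then rect p k k.+1 else rect p k.+1 k.
  by case: Rp => ->; [exists true|exists false].
have mR t : t \in R <-> exists2 u, u \in box k & t = frame v k p u.
  by rewrite RE; apply: mem_frame.
have eF u : u \in box k -> frame v k p u \in F.
  by move=> uk; apply: (fsubsetP RF); apply/mR; exists u.
have pF : frame v k p (0, 0) \in F by apply: eF; rewrite mem_box /= k0.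
(* Labels outside the box get an arbitrary tile. *)
pose e u : F := insubd [` pF]%fset (frame v k p u).
have eE u : u \in box k -> val (e u) = frame v k p u.
  by move=> uk; rewrite insubdK //; apply: eF.
pose q j := if v then shift p (0, j) else shift p (j, 0).
have acts j : j < 2 -> exists a : {perm F}, [/\ a \in puzzle_group k F,
    acts_as e (mem (box k)) a (rotn k (0, j)) &
    forall t : F, val (a t) = Defs.rot k (q j) (val t)].
  move=> j2; have qR : (rect (q j) k k `<=` R)%fset.
    apply/fsubsetP=> t; rewrite RE /q; case: (v); rewrite !mem_rect /=; lia.
  have [s sG sE] := move_exists k0 (fsubset_trans qR RF).
  exists s; split=> //; split=> [u uk|t tn].
    have [ru rE] := frame_rot v p uk j2; split=> //.
    by apply: val_inj; rewrite sE !eE.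
  apply: val_inj; rewrite sE /Defs.rot ifN //; apply/negP=> /(fsubsetP qR)/mR[u uk tE].
  by apply: (tn u uk); apply: val_inj; rewrite eE.
have [a [aG aE a_rot]] := acts 0 isT; have [b [bG bE b_rot]] := acts 1 isT.
(* In a lying piece the label (x, y) sits at offset (y, k-1-x), which changes the parity by that of
   k-1. *)
exists e, (colour p (+) (if v then false else ~~ odd k)), a, b.
split=> //.
- by move=> u w uk wk /(congr1 val); rewrite !eE //; apply: frame_inj.
- move=> u uk; rewrite eE // /frame; case: (v); rewrite colour_shift ?addbF //=.
  by move: uk; rewrite mem_box; case: (colour p) => /=; lia.
- move=> t; split=> [/mR[u uk tE]|[u uk ->]]; last by apply/mR; exists u; rewrite ?eE.
  by exists u => //; apply: val_inj; rewrite eE.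
move=> p' s p'R sE; have [p'q|p'q] : p' = q 0 \/ p' = q 1.
(* Two opposite corners of the block lie in the piece, which leaves only two positions. *)
- have corner (m n : nat) : m < k -> n < k -> shift p' (m, n) \in R.
    move=> mk nk; apply: (fsubsetP p'R); move: mk nk; rewrite mem_rect; case: (p') => x y /=; lia.
  have km : k.-1 < k by lia.
  move: (corner 0 0 k0 k0) (corner k.-1 k.-1 km km); rewrite RE /q.
  case: p' {p'R sE corner} => x' y'; case: (v); rewrite !mem_rect /shift /= => h1 h2;
    [have [yy|yy] : (y' = p.2 \/ y' = p.2 + 1)%R by lia|
     have [yy|yy] : (x' = p.1 \/ x' = p.1 + 1)%R by lia];
    by [left; congr (_, _); lia|right; congr (_, _); lia].
- by left; apply/permP=> t; apply: val_inj; rewrite sE a_rot p'q.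
by right; apply/permP=> t; apply: val_inj; rewrite sE b_rot p'q.
Qed.

Lemma piece_frame k (F R : {fset tile}) : 0 < k -> is_piece k R -> (R `<=` F)%fset ->
  exists (e : nat * nat -> F) (c : bool),
  [/\ {in box k &, injective e},
      {in box k, forall u, colour (val (e u)) = c (+) odd (u.1 + u.2)},
      forall t : F, val t \in R <-> exists2 u, u \in box k & t = e u,
      exists2 a, a \in puzzle_group k F & acts_as e (mem (box k)) a (rotn k (0, 0))
    & exists2 b, b \in puzzle_group k F & acts_as e (mem (box k)) b (rotn k (0, 1))].
Proof.
move=> k0 pR RF.
have [e [c [a [b [inj ec eR [aG bG aE bE] _]]]]] := piece_frame_moves k0 pR RF.
by exists e, c; split=> //; [exists a|exists b].
Qed.

(** * Words for large pieces *)

Lemma rotn0E k x y : x < k -> y <= k ->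
  rotn k (0, 0) (x, y) = if y < k then (y, k.-1 - x) else (x, y).
Proof.
move=> xk yk; rewrite /rotn /in_block /= add0n xk /= !subn0 !add0n.
by case: ltnP.
Qed.

Lemma rotn1E k x y : x < k -> y <= k ->
  rotn k (0, 1) (x, y) = if 0 < y then (y.-1, k - x) else (x, y).
Proof.
move=> xk yk; rewrite /rotn /in_block /= add0n xk /= !subn0 !add0n.
by case: ifP; case: ifP => * //; try lia; congr (_, _); lia.
Qed.

(** The diagonal translations bring every cell down to (0, 0) or (1, 0), according to its colour. *)
Lemma stable_colour k (P : pred (nat * nat)) : 1 < k ->
  {in box k, forall u, P (rotn k (0, 0) u) = P u} ->
  {in box k, forall u, P (rotn k (0, 1) u) = P u} ->
  {in box k &, forall u w, ~~ odd k || (odd (u.1 + u.2) == odd (w.1 + w.2)) -> P u = P w}.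
Proof.
move=> k1 PA PB.
have PA' x y : x < k -> y < k -> P (y, k.-1 - x) = P (x, y).
  by move=> xk yk; rewrite -[RHS]PA ?mem_box /= ?rotn0E ?yk //; lia.
have PB' x y : x < k -> 0 < y <= k -> P (y.-1, k - x) = P (x, y).
  by move=> xk /andP[y0 yk]; rewrite -[RHS]PB ?mem_box /= ?rotn1E ?y0 //; lia.
have up x y : x.+1 < k -> y < k -> P (x.+1, y.+1) = P (x, y).
  move=> xk yk; rewrite -(PB' x.+1) // -(PA' x y) //; last lia.
  by congr (P (_, _)); lia.
have dn x y : x.+1 < k -> y < k -> P (x, y.+1) = P (x.+1, y).
  move=> xk yk; have k1y : k.-1 - y < k by lia.
  rewrite (_ : (x, y.+1) = (x.+1.-1, k - (k.-1 - y))); last by congr (_, _); lia.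
  rewrite PB' //; last lia.
  by rewrite -PA' //; congr (P (_, _)); lia.
have low x y : x < k -> y <= k -> P (x, y) = P (odd (x + y) : nat, 0).
  elim: y x => [|y IH] x xk yk; last first.
    case: x xk => [|x] xk; last by rewrite up 1?IH //; try lia; congr (P (nat_of_bool _, _)); lia.
    by rewrite dn 1?IH //; try lia; congr (P (nat_of_bool _, _)); lia.
  (* On the bottom row, (x+2, 0) and (x, 0) are both joined to (x+1, 1). *)
  have [n] := ubnP x; elim: n x xk => // n IHn [|[|x]] xk // xn.
  rewrite -dn ?up; try lia; rewrite IHn; try lia.
  by congr (P (nat_of_bool _, _)); lia.
move=> [x y] [x' y']; rewrite !mem_box /= => /andP[xk yk] /andP[xk' yk'] H.
rewrite low // (low x') //.
have [/eqP->//|NE] := boolP (odd (x + y) == odd (x' + y')).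
have ke : ~~ odd k by rewrite (negPf NE) orbF in H.
have k0 : 0 < k by apply: ltnW.
(* For even [k] the first turn joins the corners (0, 0) and (0, k-1), which have opposite
   colours. *)
have := PA' 0 0 k0 k0; rewrite subn0 low ?leq_pred //= add0n.
have -> : odd k.-1 by move: ke k0; case: (k) => //= m; rewrite negbK.
by move=> E; move: NE E; case: odd; case: odd.
Qed.

Section Words.
Variable k : nat.
Implicit Type u : nat * nat.

Definition stepA u := if u.2 < k then (u.2, k.-1 - u.1) else u.
Definition stepB u := if 0 < u.2 then (u.2.-1, k - u.1) else u.
Definition stepA' u := if u.2 < k then (k.-1 - u.2, u.1) else u.
Definition stepB' u := if 0 < u.2 then (k - u.2, u.1.+1) else u.

(* [wordC], [wordX], [wordY]: the actions of [abab], [a^-1 b b a^-1 b a] and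
   [b a a b a^-1 b^-1], products being read from left to right. *)
Definition wordC u := stepB (stepA (stepB (stepA u))).
Definition wordX u := stepA (stepB (stepA' (stepB (stepB (stepA' u))))).
Definition wordY u := stepB' (stepA' (stepB (stepA (stepA (stepB u))))).

Definition rim u := [|| u.2 == 0, u.2 == k | u.1 == k.-1].

Lemma stepA_lt x y : y < k -> stepA (x, y) = (y, k.-1 - x).
Proof. by rewrite /stepA /= => ->. Qed.
Lemma stepA_ge x y : k <= y -> stepA (x, y) = (x, y).
Proof. by rewrite /stepA /= ltnNge => ->. Qed.
Lemma stepA'_lt x y : y < k -> stepA' (x, y) = (k.-1 - y, x).
Proof. by rewrite /stepA' /= => ->. Qed.
Lemma stepA'_ge x y : k <= y -> stepA' (x, y) = (x, y).
Proof. by rewrite /stepA' /= ltnNge => ->. Qed.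
Lemma stepB_gt x y : 0 < y -> stepB (x, y) = (y.-1, k - x).
Proof. by rewrite /stepB /= => ->. Qed.
Lemma stepB_0 x y : y <= 0 -> stepB (x, y) = (x, y).
Proof. by case: y. Qed.
Lemma stepB'_gt x y : 0 < y -> stepB' (x, y) = (k - y, x.+1).
Proof. by rewrite /stepB' /= => ->. Qed.
Lemma stepB'_0 x y : y <= 0 -> stepB' (x, y) = (x, y).
Proof. by case: y. Qed.

Ltac walk :=
  repeat match goal with
  | |- context [stepA (?x, ?y)] =>
      have [?|?] := ltnP y k; [try (exfalso; lia); rewrite (@stepA_lt x y) //|try (exfalso; lia); rewrite (@stepA_ge x y) //]
  | |- context [stepA' (?x, ?y)] =>
      have [?|?] := ltnP y k; [try (exfalso; lia); rewrite (@stepA'_lt x y) //|try (exfalso; lia); rewrite (@stepA'_ge x y) //]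
  | |- context [stepB (?x, ?y)] =>
      have [?|?] := ltnP 0 y; [try (exfalso; lia); rewrite (@stepB_gt x y) //|try (exfalso; lia); rewrite (@stepB_0 x y) //]
  | |- context [stepB' (?x, ?y)] =>
      have [?|?] := ltnP 0 y; [try (exfalso; lia); rewrite (@stepB'_gt x y) //|try (exfalso; lia); rewrite (@stepB'_0 x y) //]
  end.

Lemma rimE x y : rim (x, y) = [|| y == 0, y == k | x == k.-1].
Proof. by []. Qed.

(** For x < k-1 and 0 < y < k, [ab] sends (x, y) to (k-2-x, k-y): a half turn of this region, whose
    square is trivial. The side x = 0 belongs to the region, so only three sides remain. *)
Lemma wordC_rim u : u \in box k -> wordC u != u -> rim u.
Proof.
case: u => x y; rewrite mem_box => /andP[/= xk yk]; rewrite rimE.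
apply: contraR => R; apply/eqP; rewrite /wordC; walk; congr (_, _); lia.
Qed.

(** The supports of [c] and of its conjugate lie in the rim and in the image of the rim, so they can
    share only this corner. *)
Lemma wordX_rim u : 4 < k -> u \in box k -> rim u -> rim (wordX u) -> wordX u = (k.-1, k).
Proof.
case: u => x y k4; rewrite mem_box => /andP[/= xk yk]; rewrite rimE.
move=> /or3P[]/eqP ?; subst; rewrite /wordX; walk; rewrite rimE => ?;
  by [exfalso; lia | congr (_, _); lia].
Qed.

Lemma wordY_rim u : 4 < k -> u \in box k -> rim u -> rim (wordY u) -> wordY u = (k.-1, 0).
Proof.
case: u => x y k4; rewrite mem_box => /andP[/= xk yk]; rewrite rimE.
move=> /or3P[]/eqP ?; subst; rewrite /wordY; walk; rewrite rimE => ?;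
  by [exfalso; lia | congr (_, _); lia].
Qed.

(** These values show that each corner really lies in both supports, and they give a further point
    of the resulting 3-cycle. *)
Lemma word_values : 4 < k ->
  [/\ wordX (1, 0) = (k.-1, k), wordC (k.-1, k) = (1, 0), wordC (1, 0) = (k.-1, 3),
      wordY (1, k) = (k.-1, 0) & wordC (k.-1, 0) = (k.-2, k) /\ wordC (1, k) = (k.-1, 0)].
Proof.
move=> k4; rewrite /wordX /wordY /wordC.
by split; last split; walk; congr (_, _); lia.
Qed.
End Words.

(** For even [k] this is the whole box whatever [d] is, in accordance with a turn mixing the
    colours. *)
Definition cbox (k : nat) (d : bool) : seq (nat * nat) :=
  [seq u <- box k | ~~ odd k || (odd (u.1 + u.2) == d)].

Section FramedPiece.
Variables (T : finType) (k : nat) (e : nat * nat -> T) (G : {group {perm T}}).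
Variables a b : {perm T}.
Hypothesis k1 : 1 < k.
Hypothesis e_inj : {in box k &, injective e}.
Hypotheses (aG : a \in G) (bG : b \in G).
Hypothesis aE : acts_as e (mem (box k)) a (rotn k (0, 0)).
Hypothesis bE : acts_as e (mem (box k)) b (rotn k (0, 1)).

Lemma imset_fixed (C : {set T}) (s : {perm T}) t : s @: C = C -> (s t \in C) = (t \in C).
Proof. by move=> {1}<-; rewrite mem_imset //; apply: perm_inj. Qed.

Lemma frame_spread (C : {set T}) u : a @: C = C -> b @: C = C -> u \in box k ->
  e u \in C -> [set:: map e (cbox k (odd (u.1 + u.2)))] \subset C.
Proof.
move=> aC bC uk uC; apply/subsetP=> t; rewrite inE => /mapP[w].
rewrite mem_filter => /andP[wu wk] ->.
have H (s : {perm T}) f : s @: C = C -> acts_as e (mem (box k)) s f ->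
  {in box k, forall v, (e (f v) \in C) = (e v \in C)}.
  by move=> sC [sE _] v vk; have [_ <-] := sE v vk; rewrite imset_fixed.
by have /= -> := @stable_colour k (fun v => e v \in C) k1 (H _ _ aC aE) (H _ _ bC bE) w u wk uk wu.
Qed.

Lemma fixed_stable (C : {set T}) (s : {perm T}) t :
  (forall g, g \in G -> g @: C :&: C != set0 -> g @: C = C) ->
  s \in G -> t \in C -> s t = t -> s @: C = C.
Proof.
move=> CG sG tC st; apply: CG => //; apply/set0Pn; exists t.
by rewrite inE tC andbT -{1}st mem_imset //; apply: perm_inj.
Qed.

Lemma frame_a_step : acts_as e (mem (box k)) a (stepA k).
Proof.
apply: acts_as_eq aE => -[x y] xyk; have := xyk : (x, y) \in box k; rewrite mem_box => /andP[/= xk yk].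
by rewrite rotn0E.
Qed.

Lemma frame_b_step : acts_as e (mem (box k)) b (stepB k).
Proof.
apply: acts_as_eq bE => -[x y] xyk; have := xyk : (x, y) \in box k; rewrite mem_box => /andP[/= xk yk].
by rewrite rotn1E.
Qed.

Lemma frame_a'_step : acts_as e (mem (box k)) a^-1%g (stepA' k).
Proof.
apply: acts_asV frame_a_step => -[x y] xyk; have := xyk : (x, y) \in box k; rewrite mem_box => /andP[/= xk yk].
have [yk'|yk'] := ltnP y k; last by rewrite stepA'_ge // stepA_ge.
rewrite stepA'_lt // stepA_lt //=; split; [rewrite ?inE mem_box /=; lia|congr (_, _); lia].
Qed.

Lemma frame_b'_step : acts_as e (mem (box k)) b^-1%g (stepB' k).
Proof.
apply: acts_asV frame_b_step => -[x y] xyk; have := xyk : (x, y) \in box k; rewrite mem_box => /andP[/= xk yk].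
have [y0|y0] := ltnP 0 y; last by rewrite stepB'_0 // stepB_0.
rewrite stepB'_gt // stepB_gt //=; split; [rewrite ?inE mem_box /=; lia|congr (_, _); lia].
Qed.

Let c : {perm T} := (a * b * (a * b))%g.

Lemma frame_c : acts_as e (mem (box k)) c (wordC k).
Proof.
have h := acts_asM frame_a_step frame_b_step.
exact: (acts_asM h h).
Qed.

(** As [x] carries [u], which [c] moves, to [z], the conjugate [c ^ x] moves [z]; the last
    hypothesis excludes any other common point of the two supports. *)
Lemma frame_cyc3 x fx z u : x \in G -> acts_as e (mem (box k)) x fx ->
  u \in box k -> fx u = z -> wordC k z != z -> wordC k u != u ->
  (forall v, v \in box k -> rim k v -> rim k (fx v) -> fx v = z) ->
  exists w, uniq [:: e z; w; e (wordC k z)] /\ cyc3 (e z) w (e (wordC k z)) \in G.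
Proof.
move=> xG [xE1 xE2] uk fu cz cu meet.
have [c1 c2] := frame_c.
have cG : c \in G by rewrite !groupM.
have [zk xu] : z \in box k /\ x (e u) = e z by have [] := xE1 u uk; rewrite fu.
have [czk ce] := c1 z zk; have [cuk ceu] := c1 u uk.
have dz : (c ^ x)%g (e z) = x (c (e u)) by rewrite -xu permJ.
have [||| E U] := @comm_cyc3 T c (c ^ x)%g (e z).
- by rewrite ce; apply: contra_neq cz; apply: e_inj.
- by rewrite dz -xu; apply: contra_neq cu => /perm_inj; rewrite ceu; apply: e_inj.
- move=> t; have [t' ->] : exists t', t = x t' by exists (x^-1 t)%g; rewrite permKV.
  rewrite permJ (inj_eq perm_inj) => ct ct'.
  have box_of s : c s != s -> exists2 v, v \in box k & s = e v.
    move=> cs; have [/mapP[v vk ->]|sk] := boolP (s \in map e (box k)); first by exists v.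
    by case/eqP: cs; apply: c2 => v vk se; case/mapP: sk; exists v.
  have [v vk t'v] := box_of _ ct'; subst t'.
  have [fvk xv] := xE1 v vk; move: ct ct'; rewrite xv.
  have [_ ->] := c1 v vk; have [_ ->] := c1 _ fvk => cfv cv.
  rewrite (meet v) //; apply: wordC_rim => //.
    by apply: contra_neq cv => ->.
  by apply: contra_neq cfv => ->.
by exists ((c ^ x)%g (e z)); rewrite -ce -E; split=> //; rewrite !groupM ?groupV ?groupJ.
Qed.

Lemma cyc3_frame_spread u v (S : {set T}) : 2 < #|S| -> has_cyc3s G S ->
  e u \in S -> e v \in S -> u \in box k -> v \in box k ->
  a (e u) = e u -> b (e v) = e v ->
  has_cyc3s G [set:: map e (cbox k (odd (u.1 + u.2)))].
Proof.
move=> S3 /(max_has_cyc3s S3)[C [SC HC maxC]] uS vS uk vk au bv.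
have uC : e u \in C by apply: (subsetP SC).
have vC : e v \in C by apply: (subsetP SC).
apply: has_cyc3sS HC; apply: frame_spread => //.
  exact: fixed_stable aG uC au.
exact: fixed_stable bG vC bv.
Qed.

Lemma a_fix x : x < k -> a (e (x, k)) = e (x, k).
Proof.
move=> xk; have [|_ ->] := frame_a_step.1 (x, k); first by rewrite mem_box /= xk leqnn.
by rewrite stepA_ge.
Qed.

Lemma b_fix x : x < k -> b (e (x, 0)) = e (x, 0).
Proof.
move=> xk; have [|_ ->] := frame_b_step.1 (x, 0); first by rewrite mem_box /= xk.
by rewrite stepB_0.
Qed.

Lemma frame_X : exists2 x, x \in G & acts_as e (mem (box k)) x (wordX k).
Proof.
exists (a^-1 * b * b * a^-1 * b * a)%g; first by rewrite !groupM ?groupV.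
have hA := frame_a_step; have hB := frame_b_step; have hA' := frame_a'_step.
exact: (acts_asM (acts_asM (acts_asM (acts_asM (acts_asM hA' hB) hB) hA') hB) hA).
Qed.

Lemma frame_Y : exists2 x, x \in G & acts_as e (mem (box k)) x (wordY k).
Proof.
exists (b * a * a * b * a^-1 * b^-1)%g; first by rewrite !groupM ?groupV.
have hA := frame_a_step; have hB := frame_b_step.
have hA' := frame_a'_step; have hB' := frame_b'_step.
exact: (acts_asM (acts_asM (acts_asM (acts_asM (acts_asM hB hA) hA) hB) hA') hB').
Qed.

Lemma card_set3 (x y z : T) : uniq [:: x; y; z] -> 2 < #|[set x; y; z]|.
Proof.
have -> : [set x; y; z] = [set:: [:: x; y; z]] by apply/setP=> t; rewrite !inE orbA.
by move=> U; rewrite cardsE; move/card_uniqP: U => ->.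
Qed.

Lemma cbox_even d d' : ~~ odd k -> cbox k d = cbox k d'.
Proof. by move=> ke; apply: eq_filter => u; rewrite ke. Qed.

Lemma frame_full5 d : 4 < k -> has_cyc3s G [set:: map e (cbox k d)].
Proof.
move=> k4; have [X1 C1 C2 Y1 [C3 C4]] := word_values k4.
have neq (x y x' y' : nat) : (x != x') || (y != y') -> (x, y) != (x', y').
  by rewrite -pair_eqE /= negb_and.
have full_X : has_cyc3s G [set:: map e (cbox k (odd (k.-1 + k)))].
  have [x xG xE] := frame_X.
  have [||||w []] := frame_cyc3 xG xE (u := (1, 0)) (z := (k.-1, k)) _ X1.
  - by rewrite mem_box /= k1.
  - by rewrite C1; apply: neq; lia.
  - by rewrite C2; apply: neq; lia.
  - by move=> v; apply: wordX_rim.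
  rewrite C1 => U /(has_cyc3s_set3 U) H.
  (* [c] sends the corner (k-1, k), on a row fixed by [a], to (1, 0), on a row fixed by [b], so the
     3-cycle contains both kinds of fixed tiles. *)
  apply: (cyc3_frame_spread (card_set3 U) H (u := (k.-1, k)) (v := (1, 0)));
    rewrite ?inE ?eqxx ?orbT ?mem_box //= ?a_fix ?b_fix //; lia.
have full_Y : has_cyc3s G [set:: map e (cbox k (odd (k.-2 + k)))].
  have [x xG xE] := frame_Y.
  have [||||w []] := frame_cyc3 xG xE (u := (1, k)) (z := (k.-1, 0)) _ Y1.
  - by rewrite mem_box /= k1 leqnn.
  - by rewrite C3; apply: neq; lia.
  - by rewrite C4; apply: neq; lia.
  - by move=> v; apply: wordY_rim.
  rewrite C3 => U /(has_cyc3s_set3 U) H.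
  apply: (cyc3_frame_spread (card_set3 U) H (u := (k.-2, k)) (v := (k.-1, 0)));
    rewrite ?inE ?eqxx ?orbT ?mem_box //= ?a_fix ?b_fix //; lia.
(* The two 3-cycles have label parities 2k-1 and 2k-2: one for each colour if [k] is odd, while
   either one suffices if [k] is even. *)
have [ko|ke] := boolP (odd k); last by rewrite (cbox_even _ (odd (k.-1 + k))).
have -> : d = if d then odd (k.-1 + k) else odd (k.-2 + k) by case: (d); lia.
by case: (d).
Qed.

Definition frame_gens := [:: rotn k (0, 0); rotn k (0, 1)].

Lemma frame_gens_acts i :
  exists2 s, s \in G & acts_as e (mem (box k)) s (nth id frame_gens i).
Proof.
case: i => [|[|i]]; [by exists a|by exists b|].
by exists 1%g; rewrite ?group1 //= nth_nil; apply: acts_as1.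
Qed.

End FramedPiece.

(** The 35th power of the word is a 3-cycle, and nine passes of [grow] reach all twenty labels. *)
Lemma box4_spreads : spreads (frame_gens 4) (box 4)
  (power_word (box 4) (frame_gens 4) [:: 0; 1; 1; 1; 0; 0; 1; 0; 0; 1; 1; 1] [:: 5; 7]) 9 (box 4).
Proof. by vm_compute. Qed.

Lemma frame_full (T : finType) k (e : nat * nat -> T) (G : {group {perm T}}) a b d :
  3 < k -> {in box k &, injective e} -> a \in G -> b \in G ->
  acts_as e (mem (box k)) a (rotn k (0, 0)) ->
  acts_as e (mem (box k)) b (rotn k (0, 1)) ->
  has_cyc3s G [set:: map e (cbox k d)].
Proof.
move=> k3 inj aG bG aE bE; have k1 : 1 < k by apply: ltn_trans k3.
case: (ltngtP k 4) k3 => // [k4 _|k4 _]; first exact: (frame_full5 (a := a) (b := b)).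
subst k; apply: has_cyc3sS (spreads_word_sound inj (frame_gens_acts aG bG aE bE) box4_spreads).
apply/subsetP=> t; rewrite !in_set => /mapP[u]; rewrite mem_filter => /andP[_ u4] ->.
exact: map_f.
Qed.

(** * Two overlapping pieces *)

Definition npiece (v : bool) k (q : nat * nat) : seq (nat * nat) :=
  allpairs pair (iota q.1 (if v then k else k.+1)) (iota q.2 (if v then k.+1 else k)).

Lemma mem_npiece v k q u : (u \in npiece v k q) =
  (q.1 <= u.1 < q.1 + (if v then k else k.+1)) &&
  (q.2 <= u.2 < q.2 + (if v then k.+1 else k)).
Proof.
apply/allpairsP/idP => [[[i j] [+ + ->]]|/andP[u1 u2]].
  by rewrite !mem_iota /= => -> ->.
by exists u; rewrite !mem_iota u1 u2 -surjective_pairing.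
Qed.

Definition nblock (v : bool) (q : nat * nat) : nat * nat :=
  if v then (q.1, q.2.+1) else (q.1.+1, q.2).

Definition npair v1 v2 k q1 q2 := undup (npiece v1 k q1 ++ npiece v2 k q2).

Definition pair_gens v1 v2 k q1 q2 : seq (nat * nat -> nat * nat) :=
  [:: rotn k q1; rotn k (nblock v1 q1); rotn k q2; rotn k (nblock v2 q2)].

Definition ccells k (d : bool) (L : seq (nat * nat)) : seq (nat * nat) :=
  [seq u <- L | ~~ odd k || (odd (u.1 + u.2) == d)].

(* Unlike [has], [lazy_has] stops at the first success under [vm_compute],
   which evaluates both arguments of [||]. *)
Fixpoint lazy_has (A : Type) (p : pred A) (s : seq A) : bool :=
  if s is x :: s' then if p x then true else lazy_has p s' else false.

Lemma lazy_hasE (A : Type) (p : pred A) s : lazy_has p s = has p s.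
Proof. by elim: s => //= x s ->; case: (p x). Qed.

(** Six is the size of a class in a single piece for [k] = 2 and [k] = 3; exceeding it guarantees a
    tile outside any piece added later. *)
Definition pair_full k (ws : seq (seq nat)) v1 v2 q1 q2 d : bool :=
  let L := npair v1 v2 k q1 q2 in
  let fs := pair_gens v1 v2 k q1 q2 in
  let A := ccells k d L in
  (6 < size A) && lazy_has (fun w => spreads fs L (power_word L fs w [:: 2; 2; 2; 5; 7]) 9 A) ws.

(** Two rectangles intersect in a rectangle, so two common tiles already provide two adjacent ones,
    and counting is enough. *)
Definition meets k (L1 L2 : seq (nat * nat)) : bool :=
  (if odd k then 1 else 0) < count (mem L1) L2.

(** A piece meeting the first one has its corner within [k] of [q1] along each axis, hence natural
    coordinates between 1 and 2k+1. Conditionals are used because they evaluate only the branch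
    taken. *)
Definition pairs_full k ws v1 v2 : bool :=
  let q1 := (k.+1, k.+1) in
  all (fun x => all (fun y => let q2 := (x, y) in
    if ~~ meets k (npiece v1 k q1) (npiece v2 k q2) then true
    else if (v1 == v2) && (q1 == q2) then true
    else pair_full k ws v1 v2 q1 q2 true && pair_full k ws v1 v2 q1 q2 false)
    (iota 0 (k.*2 + 3))) (iota 0 (k.*2 + 3)).

(* Words in the four turns of [pair_gens], found by computer: for each position of
   the second piece some word has a 280th power which is a 3-cycle. *)
Definition words2 : seq (seq nat) :=
  [:: [:: 0; 1; 1; 1; 2; 2]; [:: 0; 0; 2; 3; 3; 3]; [:: 1; 1; 3; 3];
      [:: 0; 0; 3; 3]; [:: 1; 1; 2; 2]].

Definition words3 : seq (seq nat) :=
  [:: [:: 0; 1; 1; 1; 2; 2]; [:: 0; 0; 2; 3; 3; 3]; [:: 0; 3; 3; 1; 1; 1];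
      [:: 1; 1; 2; 2; 2; 3]; [:: 1; 1; 0; 0; 1; 1; 3; 3]; [:: 0; 0; 0; 3; 3; 1; 1; 2; 2];
      [:: 0; 0; 2; 2; 1; 1; 1; 3; 3]; [:: 0; 0; 0; 3; 0; 0; 2; 2];
      [:: 0; 0; 2; 2; 2; 3; 3; 2]; [:: 0; 1; 1; 1; 2; 2; 3; 3];
      [:: 0; 3; 3; 3; 2; 1; 1]; [:: 0; 0; 3; 3; 1; 1; 2]].

Lemma pairs2_full v1 v2 : pairs_full 2 words2 v1 v2.
Proof. by case: v1; case: v2; vm_compute. Qed.

Lemma pairs3_full v1 v2 : pairs_full 3 words3 v1 v2.
Proof. by case: v1; case: v2; vm_compute. Qed.

(** For odd [k], [d = true] selects the white tiles; for even [k] both values give all of [R]. *)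
Definition cells k (F R : {fset tile}) (d : bool) : {set F} :=
  [set t : F | (val t \in R) && (~~ odd k || (colour (val t) == d))].

Lemma mem_shift v k p q t :
  t \in (if v then rect (shift p q) k k.+1 else rect (shift p q) k.+1 k) <->
  exists2 u, u \in npiece v k q & t = shift p u.
Proof.
split; last first.
  by case=> [[x y]]; rewrite mem_npiece; case: v => /= H ->; rewrite mem_rect /=; lia.
case: t => x y; case: v; rewrite mem_rect /= => H;
  exists (`|x - p.1|%N, `|y - p.2|%N); rewrite ?mem_npiece /shift /=; try lia;
  congr (_, _); lia.
Qed.

Lemma meetsP k (R1 R2 : {fset tile}) p L1 L2 : uniq L2 ->
  (forall t, t \in R1 <-> exists2 u, u \in L1 & t = shift p u) ->
  (forall t, t \in R2 <-> exists2 u, u \in L2 & t = shift p u) ->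
  overlaps k R1 R2 -> meets k L1 L2.
Proof.
move=> U2 m1 m2; rewrite /meets -size_filter.
have both t : t \in (R1 `&` R2)%fset ->
  exists2 u, u \in [seq u <- L2 | mem L1 u] & t = shift p u.
  rewrite in_fsetI => /andP[/m1[u u1 tu] /m2[u' u2 tu']].
  have uu' : u = u' by apply: (@shift_inj p); rewrite -tu.
  by exists u; rewrite // mem_filter -[mem L1 u]/(u \in L1) u1 uu'.
rewrite /overlaps; case: ifP => _; last first.
  by case=> t /both[u]; case: filter.
case=> s [t [/both[u us ->] /both[w ws ->]]].
rewrite /adjacent => adj.
have uw : u != w by apply: contraTneq adj => ->; rewrite /= !subrr.
have /uniq_leq_size/(_ _) : uniq [:: u; w] by rewrite /= inE uw.
by apply=> x; rewrite !inE => /orP[]/eqP->.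
Qed.

(** Moving the origin to [p0] puts the corner of the first piece at (k+1, k+1), where the finite
    check applies; equal pieces are the case that it leaves aside. *)
Lemma pair_sound k ws (F R1 R2 : {fset tile}) :
  0 < k -> is_piece k R1 -> is_piece k R2 -> (R1 `<=` F)%fset -> (R2 `<=` F)%fset ->
  overlaps k R1 R2 -> (forall v1 v2, pairs_full k ws v1 v2) ->
  R1 = R2 \/ forall d, has_cyc3s (puzzle_group k F) (cells k F (R1 `|` R2)%fset d) /\
                       6 < #|cells k F (R1 `|` R2)%fset d|.
Proof.
move=> k0 [p1 P1] [p2 P2] RF1 RF2 ov full.
have orient R p : R = rect p k k.+1 \/ R = rect p k.+1 k ->
  exists v : bool, R = if v then rect p k k.+1 else rect p k.+1 k.
  by case=> ->; [exists true|exists false].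
have [v1 E1] := orient _ _ P1; have [v2 E2] := orient _ _ P2.
pose p0 : tile := (p1.1 - Posz k.+1, p1.2 - Posz k.+1)%R.
pose q1 := (k.+1, k.+1).
have p1E : p1 = shift p0 q1 by rewrite [p1]surjective_pairing /shift /=; congr (_, _); lia.
have [q2 p2E q2b] : exists2 q2, p2 = shift p0 q2 & (q2.1 < k.*2 + 3) && (q2.2 < k.*2 + 3).
  have [t /andP[]] : exists t, (t \in R1) && (t \in R2).
    move: ov; rewrite /overlaps; case: ifP => _ [s]; last by rewrite in_fsetI; exists s.
    by case=> t []; rewrite in_fsetI; exists s.
  case: t p1 p2 {P1 P2 p1E} @p0 E1 E2 => x y [x1 y1] [x2 y2] /= -> ->.
  move=> h1 h2; exists (`|(x2 - (x1 - Posz k.+1))%R|%N, `|(y2 - (y1 - Posz k.+1))%R|%N);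
    move: h1 h2; case: v1; case: v2; rewrite !mem_rect /= => h1 h2;
    rewrite /shift /=; try lia; congr (_, _); lia.
have m1 t : t \in R1 <-> exists2 u, u \in npiece v1 k q1 & t = shift p0 u.
  by rewrite E1 p1E; apply: mem_shift.
have m2 t : t \in R2 <-> exists2 u, u \in npiece v2 k q2 & t = shift p0 u.
  by rewrite E2 p2E; apply: mem_shift.
have meet : meets k (npiece v1 k q1) (npiece v2 k q2).
  apply: meetsP m1 m2 ov; apply: allpairs_uniq; rewrite ?iota_uniq //.
  by move=> [? ?] [? ?].
have /allP/(_ q2.1) := full v1 v2; rewrite mem_iota /=; case/andP: q2b => -> q2b.
move=> /(_ isT)/allP/(_ q2.2); rewrite mem_iota /= q2b => /(_ isT).
rewrite -surjective_pairing meet /=; case: ifP => [/andP[/eqP v12 /eqP q12] _|_ /andP[ft ff]].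
  have {q12}-> : R2 = if v2 then rect (shift p0 q1) k k.+1 else rect (shift p0 q1) k.+1 k.
    by rewrite E2 p2E; congr (if v2 then rect (shift p0 _) _ _ else rect (shift p0 _) _ _).
  by left; rewrite E1 p1E v12.
right=> d.
set L := npair v1 v2 k q1 q2.
have mL t : t \in (R1 `|` R2)%fset <-> exists2 u, u \in L & t = shift p0 u.
  rewrite in_fsetU; split=> [/orP[/m1|/m2][u uL ->]|[u]].
  - by exists u; rewrite // mem_undup mem_cat uL.
  - by exists u; rewrite // mem_undup mem_cat uL orbT.
  rewrite mem_undup mem_cat => /orP[] uL tu; apply/orP; [left|right].
    by apply/m1; exists u.
  by apply/m2; exists u.
have LF u : u \in L -> shift p0 u \in F.
  move=> uL; have : shift p0 u \in (R1 `|` R2)%fset by apply/mL; exists u.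
  by rewrite in_fsetU => /orP[]; apply: fsubsetP.
have p1F : p1 \in F by apply: (fsubsetP RF1); rewrite E1; case: (v1); rewrite mem_rect !lexx !ltrDl; lia.
pose e u : F := insubd [` p1F]%fset (shift p0 u).
have eE u : u \in L -> val (e u) = shift p0 u by move=> uL; rewrite insubdK //; apply: LF.
have e_inj : {in L &, injective e}.
  by move=> u w uL wL /(congr1 val); rewrite !eE // => /shift_inj.
have block_acts q : (forall u, in_block k q u -> u \in L) ->
  exists2 s, s \in puzzle_group k F & acts_as e (mem L) s (rotn k q).
  move=> qL; have blockP t : t \in rect (shift p0 q) k k ->
    exists2 u, in_block k q u & t = shift p0 u.
    case: t => x y; rewrite mem_rect /= => H.
    exists (`|x - p0.1|%N, `|y - p0.2|%N); first by rewrite /in_block /=; lia.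
    by rewrite /shift /=; congr (_, _); lia.
  have qF : (rect (shift p0 q) k k `<=` F)%fset.
    by apply/fsubsetP=> t /blockP[u /qL/LF uF ->].
  have [s sG sE] := move_exists k0 qF; exists s => //; split=> [u uL|t tn].
    have ruL : rotn k q u \in L.
      have [h|h] := boolP (in_block k q u); last by rewrite /rotn (negPf h).
      apply: qL; move: h; rewrite /rotn /in_block /= => h; rewrite h /=; lia.
    by split=> //; apply: val_inj; rewrite sE !eE // rot_shift.
  apply: val_inj; rewrite sE /Defs.rot ifN //; apply/negP=> /blockP[u /qL uL tE].
  by apply: (tn u uL); apply: val_inj; rewrite eE.
have gens i : exists2 s, s \in puzzle_group k F &
    acts_as e (mem L) s (nth id (pair_gens v1 v2 k q1 q2) i).
  have sub1 u : u \in npiece v1 k q1 -> u \in L by rewrite mem_undup mem_cat => ->.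
  have sub2 u : u \in npiece v2 k q2 -> u \in L by rewrite mem_undup mem_cat orbC => ->.
  case: i => [|[|[|[|i]]]] /=.
  - apply: block_acts => u h; apply: sub1; move: h; rewrite mem_npiece /in_block.
    by case: (v1) => /=; lia.
  - apply: block_acts => u h; apply: sub1; move: h; rewrite mem_npiece /in_block.
    by case: (v1) => /=; lia.
  - apply: block_acts => u h; apply: sub2; move: h; rewrite mem_npiece /in_block.
    by case: (v2) => /=; lia.
  - apply: block_acts => u h; apply: sub2; move: h; rewrite mem_npiece /in_block.
    by case: (v2) => /=; lia.
  by exists 1%g; rewrite ?group1 //= nth_nil; apply: acts_as1.
(* Label parity and tile colour differ by the colour of the new origin. *)
have cellsE b : cells k F (R1 `|` R2)%fset (colour p0 (+) b) = [set:: map e (ccells k b L)].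
  apply/setP=> t; rewrite in_set in_set; apply/andP/mapP => [[/mL[u uL tu] tc]|[u]].
    exists u; last by apply: val_inj; rewrite eE.
    rewrite mem_filter uL andbT; move: tc; rewrite tu colour_shift.
    by case: (odd k) => //=; case: (colour p0); case: b; case: (odd _).
  rewrite mem_filter => /andP[uc uL ->]; rewrite eE //; split; first by apply/mL; exists u.
  move: uc; rewrite colour_shift.
  by case: (odd k) => //=; case: (colour p0); case: b; case: (odd _).
have {ft ff} : pair_full k ws v1 v2 q1 q2 (colour p0 (+) d) by case: (_ (+) d).
rewrite -[d in cells _ _ _ d](addKb (colour p0)) cellsE /pair_full lazy_hasE => /andP[A6 /hasP[w _ wA]].
split; first exact: (spreads_word_sound e_inj gens wA).
rewrite cardsE (card_uniqP _) ?size_map // map_inj_in_uniq ?filter_uniq ?undup_uniq //.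
by move=> u u'; rewrite !mem_filter => /andP[_ uL] /andP[_ u'L]; apply: e_inj.
Qed.

(** * Admissible figures *)

Lemma size_cbox_gt2 k d : 3 < k -> 2 < size (cbox k d).
Proof.
move=> k3; have H s : uniq s -> {subset s <= cbox k d} -> size s <= size (cbox k d).
  exact: uniq_leq_size.
case: d H => H; [apply: (H [:: (1, 0); (0, 1); (2, 1)])|apply: (H [:: (0, 0); (1, 1); (2, 0)])] => // u;
  rewrite !inE => /or3P[]/eqP->; rewrite mem_filter mem_box /= ?orbT; lia.
Qed.

Section Absorb.
Variables (k : nat) (F R : {fset tile}).
Hypotheses (k1 : 1 < k) (pR : is_piece k R) (RF : (R `<=` F)%fset).
Let G := puzzle_group k F.

Lemma cells_frame (e : nat * nat -> F) c d :
  {in box k, forall u, colour (val (e u)) = c (+) odd (u.1 + u.2)} ->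
  (forall t : F, val t \in R <-> exists2 u, u \in box k & t = e u) ->
  cells k F R (c (+) d) = [set:: map e (cbox k d)].
Proof.
move=> ec eR; apply/setP=> t; rewrite !in_set; apply/andP/mapP => [[/eR[u uk ->]]|[u]].
  rewrite ec // => H; exists u => //; rewrite mem_filter uk andbT.
  by move: H; case: (odd k) => //=; case: c {ec}; case: d; case: odd.
rewrite mem_filter => /andP[H uk] ->; rewrite ec //; split; first by apply/eR; exists u.
by move: H; case: (odd k) => //=; case: c {ec}; case: d; case: odd.
Qed.

Lemma piece_cells_full d : 3 < k -> has_cyc3s G (cells k F R d) /\ 2 < #|cells k F R d|.
Proof.
move=> k3; have [e [c [inj ec eR [a aG aE] [b bG bE]]]] := piece_frame (ltnW k1) pR RF.
rewrite -[d](addKb c) (cells_frame _ ec eR); split; first exact: (frame_full _ _ _ aG bG).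
rewrite cardsE (card_uniqP _) ?size_map ?size_cbox_gt2 // map_inj_in_uniq.
  by rewrite filter_uniq // allpairs_uniq ?iota_uniq // => -[? ?] [? ?].
by move=> u u'; rewrite !mem_filter => /andP[_ uL] /andP[_ u'L]; apply: inj.
Qed.

Lemma piece_cells_small d : k < 4 -> #|cells k F R d| <= 6.
Proof.
move=> k4; have [e [c [inj ec eR _ _]]] := piece_frame (ltnW k1) pR RF.
rewrite -[d](addKb c) (cells_frame _ ec eR) cardsE.
apply: (leq_trans (card_size _)); rewrite size_map.
by case: (c (+) d); move: k1 k4; case: (k) => [|[|[|[|n]]]].
Qed.

(** Both turns of [R] fix [t'], a tile outside [R]; so the block containing [S] is stable under
    them, and through [t] it swallows the whole class of [R]. *)
Lemma absorb_piece (S : {set F}) d t t' : 2 < #|S| -> has_cyc3s G S ->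
  t \in S -> t \in cells k F R d -> t' \in S -> val t' \notin R ->
  has_cyc3s G (S :|: cells k F R d).
Proof.
move=> S3 HS tS tR t'S t'R.
have [e [c [inj ec eR [a aG aE] [b bG bE]]]] := piece_frame (ltnW k1) pR RF.
have [C [SC HC maxC]] := max_has_cyc3s S3 HS.
have tfix s f : acts_as e (mem (box k)) s f -> s t' = t'.
  case=> _; apply=> u uk te; case/negP: t'R; apply/eR; by exists u.
have t'C := subsetP SC _ t'S.
have aC := fixed_stable maxC aG t'C (tfix _ _ aE).
have bC := fixed_stable maxC bG t'C (tfix _ _ bE).
apply: has_cyc3sS HC; rewrite subUset SC /=.
have [u uk tu] : exists2 u, u \in box k & t = e u.
  by apply/eR; move: tR; rewrite in_set => /andP[].
have uC : e u \in C by rewrite -tu; apply: (subsetP SC).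
apply: subset_trans (frame_spread k1 aE bE aC bC uk uC).
rewrite -(cells_frame _ ec eR); apply/subsetP=> s; move: tR; rewrite !in_set tu ec //.
move=> /andP[_ h] /andP[-> /=]; move: h; case: (odd k) => //=.
by move=> /eqP->.
Qed.

End Absorb.

Lemma cellsU k (F R1 R2 : {fset tile}) d :
  cells k F (R1 `|` R2)%fset d = cells k F R1 d :|: cells k F R2 d.
Proof. by apply/setP=> t; rewrite !in_set in_fsetU andb_orl. Qed.

Lemma adjacent_colour s t : adjacent s t -> colour s = ~~ colour t.
Proof. rewrite /adjacent /colour; case: s t => a b [c d] /=; lia. Qed.

(** Of two adjacent tiles one has the colour [d]; this is what the stronger overlap for odd [k]
    provides. *)
Lemma overlaps_cells k (F R1 R2 : {fset tile}) d : (R1 `<=` F)%fset -> overlaps k R1 R2 ->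
  exists2 t, t \in cells k F R1 d & t \in cells k F R2 d.
Proof.
move=> /fsubsetP RF ov.
have [t tI tc] : exists2 t, t \in (R1 `&` R2)%fset & ~~ odd k || (colour t == d).
  move: ov; rewrite /overlaps; case: ifP => _ [s]; last by exists s.
  case=> t [sI tI /adjacent_colour st].
  have [sd|sd] := eqVneq (colour s) d; first by exists s; rewrite ?sd ?eqxx ?orbT.
  by exists t => //; apply/orP; right; move: st sd; case: colour; case: colour; case: (d).
move: tI; rewrite in_fsetI => /andP[t1 t2].
by exists [` RF t t1]%fset; rewrite in_set /= ?t1 ?t2.
Qed.

(** The group is that of the final figure [F0] while the subfigure [F] grows inside it. For [k] < 4
    the first alternative lasts as long as the same piece is placed again; for larger [k] every
    piece is full by itself and overlapping classes merge. *)
Lemma admissible_full k (F : {fset tile}) : 1 < k -> admissible k F ->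
  forall F0 : {fset tile}, (F `<=` F0)%fset ->
  (k < 4 /\ is_piece k F) \/
  forall d, has_cyc3s (puzzle_group k F0) (cells k F0 F d) /\
            (if k < 4 then 6 else 2) < #|cells k F0 F d|.
Proof.
move=> k1; elim=> [R pR|{}F R _ IH pR ov] F0 RF0.
  case: (ltnP k 4) => k4; first by left.
  by right=> d; apply: piece_cells_full.
have [FF0 RF] : (F `<=` F0)%fset /\ (R `<=` F0)%fset.
  by move: RF0; rewrite fsubUset => /andP[].
have [[k4 pF]|full] := IH F0 FF0.
  have k23 : k = 2 \/ k = 3 by lia.
  have [ws ws_full] : exists ws, forall v1 v2, pairs_full k ws v1 v2.
    case: k23 => ->; [exists words2; apply: pairs2_full|exists words3; apply: pairs3_full].
  have [->|H] := pair_sound (ltnW k1) pR pF RF FF0 ov ws_full.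
    by left; rewrite fsetUid.
  by right=> d; rewrite k4.
right=> d; have [HF F6] := full d.
have [t tR tF] := overlaps_cells d RF ov.
split; last by apply: leq_trans F6 _; rewrite cellsU subset_leq_card // subsetUr.
rewrite cellsU; case: (ltnP k 4) F6 => k4 F6.
  (* More than six cells do not fit into one piece, so some cell of the class lies outside [R]. *)
  have [sub|/subsetPn[t' t'F t'R]] := boolP (cells k F0 F d \subset cells k F0 R d).
    by have := subset_leq_card sub; rewrite leqNgt (leq_ltn_trans _ F6) // piece_cells_small.
  rewrite setUC; apply: (absorb_piece k1 pR RF _ HF tF tR t'F); first exact: leq_trans F6.
  by apply: contra t'R; move: t'F; rewrite !in_set => /andP[_ ->] ->.
have [HR R2] := piece_cells_full k1 pR RF d k4.
by apply: has_cyc3sU => //; apply/set0Pn; exists t; rewrite inE tR.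
Qed.

(** * Parity of a move *)

(** All nontrivial cycles have length 4; the induction removes one of them, an odd permutation, at a
    time. *)
Lemma odd_quarter (T : finType) (u : {perm T}) :
  (forall t, u (u (u (u t))) = t) -> (forall t, u t != t -> u (u t) != t) ->
  odd_perm u = odd (#|[set t | u t != t]| %/ 4).
Proof.
have [n] := ubnP #|[set t | u t != t]|; elim: n u => // n IH u un u4 u2.
have [S0|/set0Pn[x]] := eqVneq [set t | u t != t] set0.
  rewrite S0 cards0; suff -> : u = 1%g by rewrite odd_perm1.
  apply/permP=> t; rewrite perm1; apply/eqP.
  by have := in_set0 t; rewrite -S0 inE => /negbFE.
rewrite inE => ux.
pose y := u x; pose z := u y; pose w := u z.
have wx : u w = x by apply: u4.
have xz : x != z by rewrite eq_sym u2.
have xy : x != y by rewrite eq_sym.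
have yz : y != z by rewrite (inj_eq perm_inj).
have zw : z != w by rewrite (inj_eq perm_inj).
have yw : y != w by rewrite eq_sym (u2 y) // eq_sym.
have xw : x != w by apply: contra_neq xy => xw; have := wx; rewrite -xw => /esym.
(* The three transpositions undo the cycle x, y, z, w of [u]. *)
pose u' := (u * tperm x w * tperm x z * tperm x y)%g.
have u'E t : u' t = if t \in [:: x; y; z; w] then t else u t.
  rewrite !permM !inE.
  have wz : w != z by rewrite eq_sym.
  have zy : z != y by rewrite eq_sym.
  have wy : w != y by rewrite eq_sym.
  have [->|tx] := eqVneq t x; first by rewrite (tpermD xy) // (tpermD xy) // tpermR.
  have [->|ty] := eqVneq t y; first by rewrite (tpermD xz) // tpermR tpermL.
  have [->|tz] := eqVneq t z; first by rewrite (tpermR x w) tpermL tpermD.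
  have [->|tw] := eqVneq t w; first by rewrite wx tpermL !tpermD.
  have uE v v' : t != v -> u v = v' -> v' != u t.
    by move=> tv <-; rewrite (inj_eq perm_inj) eq_sym.
  by rewrite !tpermD //; first [exact: uE tw wx | exact: uE tx erefl | exact: uE ty erefl | exact: uE tz erefl].
have mem_u t : (u t \in [:: x; y; z; w]) = (t \in [:: x; y; z; w]).
  rewrite !inE -{1}wx !(inj_eq perm_inj).
  by case: (t == x); case: (t == y); case: (t == z); case: (t == w).
have U : uniq [:: x; y; z; w].
  by rewrite /= !inE !negb_or xy xz xw yz yw zw.
have sup : #|[set t | u t != t]| = #|[set t | u' t != t]| + 4.
  rewrite -(cardsID [set:: [:: x; y; z; w]] [set t | u t != t]) addnC; congr (_ + _).
    by apply: eq_card => t; rewrite !in_set u'E; case: ifP; rewrite ?eqxx.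
  rewrite (setIidPr _); first by rewrite cardsE (card_uniqP U).
  by apply/subsetP=> t; rewrite !in_set !inE => /or4P[] /eqP->; rewrite // ?wx // eq_sym.
have odd_u' : odd_perm u' = ~~ odd_perm u.
  by rewrite !odd_permM !odd_tperm xw xz xy; case: odd_perm.
have IHu' : odd_perm u' = odd (#|[set t | u' t != t]| %/ 4).
  apply: IH => [|t|t].
  - by move: un; rewrite sup; lia.
  - rewrite !u'E; have [h|h] := boolP (t \in [:: x; y; z; w]); first by rewrite !h.
    by rewrite !mem_u (negPf h) !mem_u (negPf h) !mem_u (negPf h) u4.
  rewrite !u'E; have [h|h] := boolP (t \in [:: x; y; z; w]); first by rewrite eqxx.
  by rewrite mem_u (negPf h); apply: u2.
rewrite sup divnDr // oddD addbT -IHu' odd_u' negbK //.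
Qed.

Definition square (k : nat) : seq (nat * nat) := allpairs pair (iota 0 k) (iota 0 k).

Lemma mem_square k u : (u \in square k) = (u.1 < k) && (u.2 < k).
Proof.
apply/allpairsP/idP => [[[i j] [+ + ->]]|/andP[u1 u2]].
  by rewrite !mem_iota /= => ->.
by exists u; rewrite !mem_iota /= !add0n u1 u2 -surjective_pairing.
Qed.

Lemma square_uniq k : uniq (square k).
Proof. by apply: allpairs_uniq; rewrite ?iota_uniq // => -[? ?] [? ?]. Qed.

Lemma count_square k (P : pred (nat * nat)) :
  count P (square k) = \sum_(0 <= i < k) count (fun j => P (i, j)) (iota 0 k).
Proof.
rewrite /square count_flatten sumnE !big_map /index_iota subn0.
by apply: eq_bigr => i _; rewrite count_map.
Qed.

Lemma count_odd_row i n : count (fun j => odd (i + j)) (iota 0 n) = (n + odd i)./2.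
Proof.
elim: n => [|n IH]; first by case: odd.
by rewrite -[n.+1]addn1 iotaD count_cat IH /=; lia.
Qed.

Lemma count_odd_square m :
  count (fun u => odd (u.1 + u.2)) (square m.*2.+1) = m.*2 * m.+1.
Proof.
rewrite count_square.
have E k n : odd k -> \sum_(0 <= i < n) count (fun j => odd (i + j)) (iota 0 k) = n * k./2 + n./2.
  move=> ko; elim: n => [|n IH]; first by rewrite big_geq.
  by rewrite big_nat_recr //= IH count_odd_row; lia.
apply: (etrans (E m.*2.+1 m.*2.+1 _)); rewrite /= ?odd_double // uphalf_double; nia.
Qed.

Definition turned k d (u : nat * nat) : bool :=
  (~~ odd k || (odd (u.1 + u.2) == d)) && (rotn k (0, 0) u != u).

Lemma rotn_square k u : u \in square k -> rotn k (0, 0) u = (u.2, k.-1 - u.1).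
Proof. by rewrite mem_square /rotn /in_block /= !add0n !subn0 => ->. Qed.

Lemma count_turned_even k d : ~~ odd k -> count (turned k d) (square k) = k ^ 2.
Proof.
move=> ke; rewrite (_ : k ^ 2 = size (square k)); last by rewrite size_allpairs !size_iota mulnn.
apply/eqP; rewrite -all_count; apply/allP=> -[x y] uk.
rewrite /turned ke /= rotn_square //; apply/eqP=> -[]; move: uk; rewrite mem_square /=; lia.
Qed.

(** Both colours have (k^2-1)/2 moved tiles: the even class has one tile more, but it contains the
    centre, which the turn fixes. *)
Lemma count_turned_odd m d : count (turned m.*2.+1 d) (square m.*2.+1) = m.*2 * m.+1.
Proof.
set k := m.*2.+1.
have ko : odd k by rewrite /k /= odd_double.
have fixed u : u \in square k -> (rotn k (0, 0) u != u) = (u != (m, m)).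
  move=> uk; rewrite rotn_square //; move: uk; rewrite mem_square.
  case: u => x y /= ?; rewrite -!pair_eqE /= !negb_and /k; lia.
have T1 : count (turned k true) (square k) = m.*2 * m.+1.
  rewrite -count_odd_square; apply: eq_in_count => u uk.
  rewrite /turned ko /= fixed // eqb_id; case: eqVneq => [->|]; rewrite ?andbT //=.
  by rewrite addnn odd_double.
(* The even count is what remains of the k^2-1 cells other than the centre. *)
case: d => //; apply/eqP; rewrite -(eqn_add2l (m.*2 * m.+1)) -{1}T1 -count_predUI.
have -> : count (predI (turned k true) (turned k false)) (square k) = 0.
  apply/eqP; rewrite -leqn0 leqNgt -has_count; apply/hasPn=> u _.
  by rewrite /= /turned ko /=; case: (rotn _ _ _ != _); case: odd.
rewrite addn0 (eq_in_count (a2 := predC1 (m, m))); last first.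
  by move=> u uk; rewrite /= /turned ko /= fixed //; case: (u != _); case: odd.
have := count_predC (pred1 (m, m)) (square k).
have -> : size (square k) = k * k by rewrite size_allpairs !size_iota.
have mk : (m, m) \in square k by rewrite mem_square /= /k; lia.
rewrite count_uniq_mem ?square_uniq // mk => H.
have {H} : 1 + count (predC1 (m, m)) (square k) = k * k by exact: H.
by move: (count _ _) => c; rewrite /k; nia.
Qed.

Section MoveParity.
Variables (k : nat) (F : {fset tile}) (p : tile) (s : {perm F}).
Hypothesis pF : (rect p k k `<=` F)%fset.
Hypothesis sE : forall t : F, val (s t) = Defs.rot k p (val t).
Implicit Type t : F.

Lemma block_tile t : val t \in rect p k k -> exists2 u, u \in square k & val t = shift p u.
Proof.
case: (val t) => x y; rewrite mem_rect /= => H.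
exists (`|(x - p.1)%R|%N, `|(y - p.2)%R|%N); first by rewrite mem_square /=; lia.
by rewrite /shift /=; congr (_, _); lia.
Qed.

Lemma rotn_in_square (u : nat * nat) : u \in square k -> rotn k (0, 0) u \in square k.
Proof. by move=> uk; rewrite rotn_square //; move: uk; rewrite !mem_square /=; lia. Qed.

Lemma rot_shift0 u : Defs.rot k p (shift p u) = shift p (rotn k (0, 0) u).
Proof.
by rewrite -rot_shift; congr (Defs.rot k _ _); rewrite /shift /= !addr0 -surjective_pairing.
Qed.

Lemma move_out t : val t \notin rect p k k -> s t = t.
Proof. by move=> tp; apply: val_inj; rewrite sE /Defs.rot (negPf tp). Qed.

Lemma move4 t : s (s (s (s t))) = t.
Proof.
have [/block_tile[u uk tu]|tp] := boolP (val t \in rect p k k); last by rewrite !move_out.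
apply: val_inj; rewrite !sE tu !rot_shift0; congr shift.
do 3!rewrite rotn_square ?rotn_in_square //; rewrite rotn_square.
  by case: u uk {tu} => x y; rewrite mem_square /= => *; congr (_, _); lia.
by move: uk; rewrite !mem_square /=; lia.
Qed.

(** A half turn fixes no tile of the block except a central one, which the quarter turn fixes
    too. *)
Lemma move2 t : s t != t -> s (s t) != t.
Proof.
have [/block_tile[u uk tu]|tp] := boolP (val t \in rect p k k); last first.
  by rewrite (move_out tp) eqxx.
apply: contra_neq => /(congr1 val); rewrite !sE tu !rot_shift0 => /shift_inj.
rewrite rotn_square ?rotn_in_square // rotn_square // => E.
apply: val_inj; rewrite sE tu rot_shift0 rotn_square //; congr shift.
by case: u uk {tu} E => x y; rewrite mem_square /= => h [] ? ?; congr (_, _); lia.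
Qed.

Lemma move_colour t : odd k -> colour (val (s t)) = colour (val t).
Proof.
have [/block_tile[u uk tu]|tp] := boolP (val t \in rect p k k); last by rewrite move_out.
move=> ko; rewrite sE tu rot_shift0 !colour_shift rotn_square //=.
by case: u uk {tu} => x y; rewrite mem_square /= => ?; congr (_ (+) _); lia.
Qed.

Lemma card_move_support d :
  #|[set t in cells k F F d | s t != t]| =
  count (turned k (colour p (+) d)) (square k).
Proof.
rewrite -size_filter.
have [k0|k0] := posnP k.
  rewrite [square k](_ : _ = [::]) ?k0 // eq_card0 // => t; rewrite !in_set.
  by rewrite move_out ?eqxx ?andbF // mem_rect; lia.
have pp : p \in F by apply: (fsubsetP pF); rewrite mem_rect !lexx !ltrDl; lia.
pose e u : F := insubd [` pp]%fset (shift p u).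
have eE u : u \in square k -> val (e u) = shift p u.
  case: u => x y; rewrite mem_square /= => uk; rewrite insubdK //; apply: (fsubsetP pF).
  by rewrite mem_rect /shift /= !lerDl !ltrD2l; lia.
have fixE u : u \in square k -> (s (e u) != e u) = (rotn k (0, 0) u != u).
  by move=> uk; rewrite -(inj_eq val_inj) sE eE // rot_shift0 (inj_eq (@shift_inj p)).
have colE u : u \in square k -> (~~ odd k || (colour (val (e u)) == d)) =
    (~~ odd k || (odd (u.1 + u.2) == colour p (+) d)).
  move=> uk; rewrite eE // colour_shift.
  by case: (odd k) => //=; case: (colour p); case: d; case: odd.
rewrite (_ : [set t in _ | _] = [set:: map e [seq u <- square k | turned k (colour p (+) d) u]]).
  rewrite cardsE (card_uniqP _) ?size_map // map_inj_in_uniq ?filter_uniq ?square_uniq //.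
  move=> u u'; rewrite !mem_filter => /andP[_ uk] /andP[_ uk'] /(congr1 val).
  by rewrite !eE // => /shift_inj.
apply/setP=> t; rewrite in_set in_set in_set; apply/idP/mapP => [/andP[/andP[tF tc] st]|[u]].
  have [/block_tile[u uk tu]|tp] := boolP (val t \in rect p k k); last first.
    by rewrite move_out ?eqxx in st.
  have te : t = e u by apply: val_inj; rewrite eE.
  by exists u; rewrite // mem_filter uk /turned -colE // -fixE // -te tc st.
rewrite mem_filter => /andP[/andP[uc ut] uk] ->.
by rewrite fsvalP colE // uc fixE.
Qed.

End MoveParity.

Lemma piece_card k (F : {fset tile}) : 0 < k -> is_piece k F -> #|` F| = k * k.+1.
Proof.
move=> k0 pF; have [e [c [inj _ eF _ _]]] := piece_frame k0 pF (fsubset_refl F).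
rewrite cardfE -cardsT; have -> : [set: F] = [set:: map e (box k)].
  apply/setP=> t; rewrite !in_set; apply/esym/mapP.
  by have [u uk ->] := (eF t).1 (fsvalP t); exists u.
rewrite cardsE (card_uniqP _) ?size_map ?size_allpairs ?size_iota //.
rewrite map_inj_in_uniq // allpairs_uniq ?iota_uniq //.
by move=> [? ?] [? ?].
Qed.

(** * The group of a figure of non-exceptional size *)

Section PuzzleGroup.
Variables (k : nat) (F : {fset tile}).
Hypothesis k1 : 1 < k.
Local Notation G := (puzzle_group k F).

Lemma puzzle_group_sub (H : {group {perm F}}) :
  (forall p (s : {perm F}), (rect p k k `<=` F)%fset ->
     (forall t : F, val (s t) = Defs.rot k p (val t)) -> s \in H) -> G \subset H.
Proof.
move=> gens; rewrite gen_subG; apply/subsetP=> s.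
rewrite inE => /existsP[p /andP[pF /forallP sE]].
by apply: (gens (val p)) => // t; apply/eqP.
Qed.

Lemma admissible_move : admissible k F -> exists p (s : {perm F}),
  [/\ s \in G, (rect p k k `<=` F)%fset & forall t : F, val (s t) = Defs.rot k p (val t)].
Proof.
move=> adm; have [p pF] : exists p, (rect p k k `<=` F)%fset.
  elim: adm => [R [p Rp]|{}F' R _ [p pF] _ _]; exists p; last exact: fsubsetU (introT orP (or_intror pF)).
  by apply/fsubsetP=> t; case: Rp => ->; rewrite !mem_rect; lia.
by have [s sG sE] := move_exists (ltnW k1) pF; exists p, s.
Qed.

Lemma admissible_cells : admissible k F -> (k < 4 -> #|` F| <> k * k.+1) ->
  forall d, has_cyc3s G (cells k F F d).
Proof.
move=> adm nF d; have [[k4 pF]|H] := admissible_full k1 adm (fsubset_refl F).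
  by case: (nF k4); apply: piece_card => //; apply: ltnW.
by case: (H d).
Qed.

Section Even.
Hypothesis ke : ~~ odd k.

Lemma cells_even d : cells k F F d = setT.
Proof. by apply/setP=> t; rewrite !inE fsvalP ke. Qed.

Lemma Alt_sub_even : has_cyc3s G (cells k F F true) -> 'Alt_(F : finType) \subset G.
Proof.
rewrite cells_even => /AltOn_sub; apply: subset_trans.
by apply/subsetP=> s sA; rewrite inE sA andbT inE; apply/subsetP.
Qed.

(** All k^2 tiles of the block are moved, which makes (k/2)^2 four-cycles. *)
Lemma odd_move_even p (s : {perm F}) : (rect p k k `<=` F)%fset ->
  (forall t : F, val (s t) = Defs.rot k p (val t)) -> odd_perm s = odd k./2.
Proof.
move=> pF sE; rewrite (odd_quarter (move4 pF sE) (move2 pF sE)).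
rewrite (_ : [set t | s t != t] = [set t in cells k F F true | s t != t]); last first.
  by apply/setP=> t; rewrite cells_even !inE.
rewrite (card_move_support pF sE) count_turned_even //.
have -> : k ^ 2 = k./2 ^ 2 * 4 by rewrite -[in LHS](odd_double_half k) (negPf ke); lia.
by rewrite mulnK // oddX.
Qed.

Lemma puzzle_group_even : admissible k F -> (k < 4 -> #|` F| <> k * k.+1) ->
  (k = 0 %[mod 4] -> G = 'Alt_(F : finType) :> {set {perm F}}) /\
  (k = 2 %[mod 4] -> G = 'Sym_(F : finType) :> {set {perm F}}).
Proof.
move=> adm nF; have AG := Alt_sub_even (admissible_cells adm nF true).
split=> k4; apply/eqP; rewrite eqEsubset.
  rewrite AG andbT; apply: puzzle_group_sub => p s pF sE.
  by rewrite Alt_even (odd_move_even pF sE); lia.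
apply/andP; split; first by apply/subsetP=> s _; rewrite inE.
apply/subsetP=> g _; have [p [s [sG pF sE]]] := admissible_move adm.
have os : odd_perm s by rewrite (odd_move_even pF sE); lia.
have [og|og] := boolP (odd_perm g); last by apply: (subsetP AG); rewrite Alt_even.
by rewrite -(groupMr _ sG); apply: (subsetP AG); rewrite Alt_even odd_permM og os.
Qed.

End Even.

Section Odd.
Hypothesis ko : odd k.
Local Notation B := (black F).
Local Notation W := (white F).

Lemma cells_black : cells k F F false = B.
Proof. by apply/setP=> t; rewrite !inE fsvalP ko /= /colour eqbF_neg negbK. Qed.

Lemma cells_white : cells k F F true = W.
Proof. by apply/setP=> t; rewrite !inE fsvalP ko /= eqb_id. Qed.

Lemma Sym_cent : perm.Sym W \subset 'C(perm.Sym B).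
Proof.
apply/centsP=> s; rewrite inE => sW t; rewrite inE => tB.
by apply: (perm_onC sW tB); rewrite -setI_eq0 setIC setICr.
Qed.

Lemma AltOn_Sym (A : {set F}) : AltOn A \subset perm.Sym A.
Proof. exact: subsetIl. Qed.

Lemma AltOn_cent : AltOn W \subset 'C(AltOn B).
Proof.
exact: subset_trans (AltOn_Sym _) (subset_trans Sym_cent (centS (AltOn_Sym _))).
Qed.

Lemma AltOn_TI : AltOn B :&: AltOn W = 1%g.
Proof.
apply/trivgP/subsetP=> s; rewrite in_setI !in_AltOn => /andP[/andP[+ _] /andP[+ _]].
rewrite !inE => /subsetP sB /subsetP sW; apply/eqP/permP=> t; rewrite perm1.
apply/eqP; apply: contraT => st; have := sW t st; rewrite !inE.
by have := sB t st; rewrite !inE => ->.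
Qed.

Section Move.
Variables (p : tile) (s : {perm F}).
Hypothesis pF : (rect p k k `<=` F)%fset.
Hypothesis sE : forall t : F, val (s t) = Defs.rot k p (val t).

Lemma move_stable d : s \in 'N(cells k F F d | 'P)%g.
Proof.
by apply/astabsP=> t; rewrite /= apermE !in_set !fsvalP /= (move_colour pF sE).
Qed.

(** With k = 2m+1 each colour has m(m+1)/2 four-cycles. Both restrictions thus have the same parity,
    even exactly when m is 0 or 3 modulo 4. *)
Lemma odd_move_restr d : odd_perm (restr_perm (cells k F F d) s) = odd (k./2 * k./2.+1 %/ 2).
Proof.
set X := cells k F F d; set u := restr_perm X s.
have sX t : (s t \in X) = (t \in X) by have /astabsP := move_stable d; apply.
have uE t : t \in X -> u t = s t by move=> tX; rewrite restr_permE ?move_stable.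
have uout t : t \notin X -> u t = t by move=> tX; apply: (out_perm (restr_perm_on _ _)).
rewrite odd_quarter.
- rewrite (_ : [set t | u t != t] = [set t in X | s t != t]); last first.
    apply/setP=> t; rewrite [in LHS]in_set [in RHS]in_set.
    by have [tX|tX] := boolP (t \in X); [rewrite uE|rewrite uout ?eqxx].
  rewrite (card_move_support pF sE) -[k in count _ (square k)]odd_double_half ko.
  rewrite -[k in turned k]odd_double_half ko count_turned_odd.
  by congr odd; lia.
- move=> t; have [tX|tX] := boolP (t \in X); last by rewrite !uout.
  by rewrite !uE ?sX // (move4 pF sE).
move=> t; have [tX|tX] := boolP (t \in X); last by rewrite !uout ?eqxx.
by rewrite !uE ?sX // => /(move2 pF sE).
Qed.

Lemma move_split : s = (restr_perm B s * restr_perm W s)%g.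
Proof.
have sB : s \in 'N(B | 'P)%g by rewrite -cells_black move_stable.
have sW : s \in 'N(W | 'P)%g by rewrite -cells_white move_stable.
apply/permP=> t; rewrite permM; have [tB|tB] := boolP (t \in B).
  rewrite (restr_permE sB tB) (out_perm (restr_perm_on _ _)) // in_setC negbK.
  by have /astabsP/(_ t) := sB; rewrite /= apermE tB.
have tW : t \in W by rewrite in_setC.
by rewrite [restr_perm B s t](out_perm (restr_perm_on _ _)) // restr_permE.
Qed.

End Move.

Hypothesis adm : admissible k F.
Hypothesis nF : k < 4 -> #|` F| <> k * k.+1.

Lemma AltOn_sub_puzzle : AltOn B \subset G /\ AltOn W \subset G.
Proof.
have H := admissible_cells adm nF.
by split; apply: AltOn_sub; rewrite -?cells_black -?cells_white.
Qed.

Lemma puzzle_group_17 : k = 1 %[mod 8] \/ k = 7 %[mod 8] -> AltOn B \x AltOn W = G.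
Proof.
move=> k8; have [GB GW] := AltOn_sub_puzzle.
rewrite dprodEY ?AltOn_cent ?AltOn_TI //; apply/eqP; rewrite eqEsubset join_subG GB GW /=.
apply: puzzle_group_sub => p s pF sE.
have ev : odd (k./2 * k./2.+1 %/ 2) = false.
  have [m [km|km]] : exists m, k./2 = 4 * m \/ k./2 = 4 * m + 3.
    by exists (k %/ 8); case: k8 => k8; [left|right]; move: k8 ko; lia.
    rewrite km -mulnA (_ : 4 * _ = 2 * (m * (4 * m).+1) * 2); last by nia.
    by rewrite mulnK // oddM.
  rewrite km (_ : (4 * m + 3) * _ = 2 * ((4 * m + 3) * m.+1) * 2); last by nia.
  by rewrite mulnK // oddM.
rewrite (move_split pF sE); apply: groupM; apply: mem_gen; rewrite in_setU in_AltOn.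
  by rewrite inE restr_perm_on -cells_black (odd_move_restr pF sE) ev.
apply/orP; right.
by rewrite in_AltOn inE restr_perm_on -cells_white (odd_move_restr pF sE) ev.
Qed.

(** A turn is odd on both colours, so dividing by it reduces a pair of odd permutations to a pair of
    even ones. *)
Lemma puzzle_group_35 : k = 3 %[mod 8] \/ k = 5 %[mod 8] ->
  G = EvenProd B W :> {set {perm F}}.
Proof.
move=> k8; have [GB GW] := AltOn_sub_puzzle.
have od : odd (k./2 * k./2.+1 %/ 2).
  have [m [km|km]] : exists m, k./2 = 4 * m + 1 \/ k./2 = 4 * m + 2.
    by exists (k %/ 8); case: k8 => k8; [left|right]; move: k8 ko; lia.
    rewrite km (_ : (4 * m + 1) * _ = (4 * m + 1) * (2 * m + 1) * 2); last by nia.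
    by rewrite mulnK // oddM; lia.
  rewrite km (_ : (4 * m + 2) * _ = (2 * m + 1) * (4 * m + 3) * 2); last by nia.
  by rewrite mulnK // oddM; lia.
have splitP p (s : {perm F}) : (rect p k k `<=` F)%fset ->
     (forall t : F, val (s t) = Defs.rot k p (val t)) ->
  exists b w : {perm F}, [/\ s = (b * w)%g, b \in perm.Sym B, w \in perm.Sym W, odd_perm b & odd_perm w].
  move=> pF sE; exists (restr_perm B s), (restr_perm W s).
  split; rewrite ?inE ?restr_perm_on //; first exact: (move_split pF sE).
    by rewrite -cells_black (odd_move_restr pF sE).
  by rewrite -cells_white (odd_move_restr pF sE).
apply/eqP; rewrite eqEsubset; apply/andP; split.
  rewrite /EvenProd -(cent_joinEr Sym_cent).
  apply: (@puzzle_group_sub ((perm.Sym B <*> perm.Sym W) :&: 'Alt_F)%G) => p s pF sE.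
  have [b [w [-> bB wW ob ow]]] := splitP p s pF sE.
  rewrite in_setI Alt_even odd_permM ob ow andbT.
  by apply: groupM; apply: mem_gen; rewrite in_setU ?bB ?wW ?orbT.
rewrite EvenProdE; apply/subsetP=> g /setUP[/mulsgP[b w bB wW ->]|].
  by apply: groupM; [apply: (subsetP GB)|apply: (subsetP GW)].
case/mulsgP=> b w /setDP[bB bA] /setDP[wW wA] ->.
have [p [s [sG pF sE]]] := admissible_move adm.
have [b' [w' [sbw b'B w'W ob ow]]] := splitP p s pF sE.
have odd_of A (x : {perm F}) : x \in perm.Sym A -> x \notin AltOn A -> odd_perm x.
  by move=> xA; rewrite in_AltOn xA negbK.
have comm x y : x \in perm.Sym B -> y \in perm.Sym W -> (x * y = y * x)%g.
  by move=> xB yW; apply/esym/(centsP Sym_cent).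
(* [b'] commutes with permutations of the white tiles, so the turn can be split off on the right. *)
have -> : (b * w = (b * b'^-1) * (w * w'^-1) * s)%g.
  rewrite sbw mulgA -(mulgA (b * b'^-1)%g) -(comm b' (w * w'^-1)%g) ?groupM ?groupV //.
  by rewrite !mulgA !mulgKV.
apply: groupM sG; apply: groupM.
  by apply: (subsetP GB); rewrite in_AltOn groupM ?groupV //= odd_permM odd_permV ob (odd_of _ _ bB).
by apply: (subsetP GW); rewrite in_AltOn groupM ?groupV //= odd_permM odd_permV ow (odd_of _ _ wW).
Qed.

End Odd.
End PuzzleGroup.

(** * The projective line *)

(** A faithful action on a finite family of points of a possibly infinite type. It serves for [PGL2]
    acting by conjugation on five involutions and for the twelve-tile group acting on one colour. *)
Lemma action_morphism (gT : finGroupType) (G : {group gT}) (X : eqType) (I : finType)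
    (to : X -> gT -> X) (h : I -> X) :
  injective h -> (forall x, to x 1%g = x) -> (forall x g g', to x (g * g')%g = to (to x g) g') ->
  (forall g i, g \in G -> exists j, to (h i) g = h j) ->
  (forall g, g \in G -> (forall i, to (h i) g = h i) -> g = 1%g) ->
  exists f : {morphism G >-> {perm I}},
    'injm f /\ forall g i, g \in G -> h (f g i) = to (h i) g.
Proof.
move=> h_inj to1 toM hG faith.
pose F g i := odflt i [pick j | h j == to (h i) g].
have FE g i : g \in G -> h (F g i) = to (h i) g.
  move=> gG; have [j hj] := hG g i gG; rewrite /F.
  by case: pickP => [l /eqP //|/(_ j)]; rewrite hj eqxx.
have F_inj g : g \in G -> injective (finfun (F g)).
  move=> gG i j; rewrite !ffunE => E; apply: h_inj.
  have : to (h i) g = to (h j) g by rewrite -!FE // E.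
  by move/(congr1 (to^~ g^-1%g)); rewrite -!toM mulgV !to1.
(* For [g] outside [G] the map may fail to be injective, and the value defaults to the identity. *)
pose f g : {perm I} := insubd (1%g : {perm I}) (finfun (F g)).
have fE g i : g \in G -> h (f g i) = to (h i) g.
  move=> gG; rewrite -FE // /f -pvalE [pval _]insubdK ?ffunE //.
  exact/injectiveP/F_inj.
have fM : {in G &, {morph f : g g' / (g * g')%g}}.
  move=> g g' gG g'G; apply/permP=> i; apply: h_inj.
  by rewrite permM !fE ?groupM // toM.
exists (Morphism fM); split; last exact: fE.
apply/injmP=> g g' gG g'G E.
have : (g * g'^-1)%g = 1%g.
  apply: faith; first by rewrite groupM ?groupV.
  move=> i; rewrite toM -fE // [f g]E fE // -toM mulgV; exact: to1.
by move/eqP; rewrite -eq_mulgV1 => /eqP.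
Qed.

Lemma isog_perm (gT : finGroupType) (G : {group gT}) (I : finType)
    (f : {morphism G >-> {perm I}}) :
  'injm f -> perm.Sym [set: I] \subset f @* G -> G \isog [set: {perm I}].
Proof.
move=> injf full; have -> : [set: {perm I}] = f @* G.
  apply/eqP; rewrite eqEsubset subsetT andbT; apply: subset_trans full.
  by apply/subsetP=> s _; rewrite inE; apply/subsetP.
exact: sub_isog.
Qed.

Section ProjectiveLine.
Local Open Scope ring_scope.
Variable K : finFieldType.
Implicit Types (a b c d l : K) (g : {perm option K}).

Lemma moebiusZ l a b c d : l != 0 ->
  moebius (l * a) (l * b) (l * c) (l * d) =1 moebius a b c d.
Proof.
move=> l0 [x|] /=; last first.
  by rewrite mulf_eq0 (negPf l0) -mulf_div divff // mul1r.
rewrite -!mulrA -!mulrDr mulf_eq0 (negPf l0) /=; case: ifP => // _.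
by rewrite -mulf_div divff // mul1r.
Qed.

Lemma moebius1 : moebius (1 : K) 0 0 1 =1 id.
Proof. by case=> [x|] /=; rewrite ?mul0r ?add0r ?oner_eq0 ?divr1 ?mul1r ?addr0 ?eqxx. Qed.

Lemma moebius_perm a b c d : a * d - b * c != 0 ->
  exists2 g, g \in PGL2 K & g =1 moebius a b c d.
Proof.
move=> D; have D' : d * a - (- b) * (- c) != 0 by rewrite mulrNN mulrC.
have inj : injective (moebius a b c d).
  (* The adjugate matrix inverts up to the determinant, a scalar that [moebiusZ] removes. *)
  apply: (can_inj (g := moebius d (- b) (- c) a)) => z.
  rewrite -[LHS]/((moebius d (- b) (- c) a \o moebius a b c d) z) moebiusM //.
  rewrite -[RHS](moebius1 z) -(moebiusZ 1 0 0 1 D).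
  by congr (moebius _ _ _ _ z); ring.
exists (perm inj) => [|z]; last by rewrite permE.
by apply/PGL2P; exists a, b, c, d; split=> // z; rewrite permE.
Qed.

End ProjectiveLine.

(** * Generators of PGL_2(5) and its action on five synthemes *)

Section PGL2_5.
Local Open Scope ring_scope.
Variable K : {group {perm option 'F_5}}.
Implicit Types (a b c d : 'F_5) (g : {perm option 'F_5}).

Let inK a b c d := exists2 g, g \in K & g =1 moebius a b c d.

Hypothesis inT : inK 1 1 0 1.
Hypothesis inM : inK 2 0 0 1.
Hypothesis inJ : inK 0 1 1 0.

Let inK_mul a b c d a' b' c' d' :
  a * d - b * c != 0 -> a' * d' - b' * c' != 0 ->
  inK a b c d -> inK a' b' c' d' ->
  inK (a' * a + b' * c) (a' * b + b' * d) (c' * a + d' * c) (c' * b + d' * d).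
Proof.
move=> D D' [g gK gE] [g' g'K g'E]; exists (g * g')%g; first by rewrite groupM.
by move=> z; rewrite permM gE g'E -moebiusM.
Qed.

Let inK_scale l a b c d : l != 0 -> inK a b c d -> inK (l * a) (l * b) (l * c) (l * d).
Proof. by move=> l0 [g gK gE]; exists g => // z; rewrite gE moebiusZ. Qed.

Let inK_eq a b c d a' b' c' d' : inK a b c d ->
  a = a' -> b = b' -> c = c' -> d = d' -> inK a' b' c' d'.
Proof. by move=> H <- <- <- <-. Qed.

Let inK_shift b : inK 1 b 0 1.
Proof.
have one : (1 : 'F_5) * 1 - 1 * 0 != 0 by [].
have H (n : nat) : inK 1 n%:R 0 1.
  elim: n => [|n IH].
    by exists 1%g; rewrite ?group1 // => z; rewrite perm1 moebius1.
  have D : (1 : 'F_5) * 1 - n%:R * 0 != 0 by rewrite mulr0 subr0.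
  by apply: inK_eq (inK_mul D one IH inT) _ _ _ _; rewrite ?mulrS; ring.
by have := H b; rewrite natr_Zp.
Qed.

Let inK_dilate a : a != 0 -> inK a 0 0 1.
Proof.
have two : (2 : 'F_5) * 1 - 0 * 0 != 0 by [].
have H (n : nat) : inK (2 ^+ n) 0 0 1.
  elim: n => [|n IH].
    by exists 1%g; rewrite ?group1 // => z; rewrite perm1 expr0 moebius1.
  have D : (2 ^+ n : 'F_5) * 1 - 0 * 0 != 0 by rewrite mulr0 subr0 mulr1 expf_neq0.
  by apply: inK_eq (inK_mul D two IH inM) _ _ _ _; rewrite ?exprS; ring.
(* 2 is a primitive root modulo 5: the exponents 0, 1, 3, 2 give 1, 2, 3, 4. *)
move=> a0; have [n <-] : exists n, 2 ^+ n = a; last exact: H.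
case: a a0 => [[|[|[|[|[|m]]]]] lt] // _.
- by exists 0%N; apply: val_inj.
- by exists 1%N; apply: val_inj.
- by exists 3%N; apply: val_inj.
by exists 2%N; apply: val_inj.
Qed.

(** Bruhat decomposition: for c = 0 the map is affine, and otherwise it is a/c + m/(z + d/c) with m
    = (bc - ad)/c^2. *)
Lemma PGL2_5_sub : PGL2 'F_5 \subset K.
Proof.
apply/subsetP=> g /PGL2P[a [b [c [d [D gE]]]]].
suff [g' g'K g'E] : inK a b c d by have -> : g = g'; [apply/permP=> z; rewrite gE g'E|].
have det1 (x : 'F_5) : 1 * 1 - x * 0 != 0 by rewrite mulr0 subr0 mulr1.
have det2 (x : 'F_5) : x != 0 -> x * 1 - 0 * 0 != 0 by rewrite mulr0 subr0 mulr1.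
have [c0|c0] := eqVneq c 0.
  have [a0 d0] : a != 0 /\ d != 0.
    by move: D; rewrite c0 mulr0 subr0 mulf_eq0 negb_or => /andP.
  have ad0 : a / d != 0 by rewrite mulf_neq0 ?invr_eq0.
  have := inK_mul (det2 _ ad0) (det1 (b / d)) (inK_dilate ad0) (inK_shift (b / d)).
  by move/(inK_scale d0)/inK_eq; apply; rewrite ?c0; field.
pose m := (b * c - a * d) / c ^+ 2.
have m0 : m != 0.
  by rewrite mulf_neq0 ?invr_eq0 ?expf_neq0 // -oppr_eq0 opprB.
have detJ : (0 : 'F_5) * 0 - 1 * 1 != 0 by [].
have D1 := inK_mul (det1 (d / c)) detJ (inK_shift (d / c)) inJ.
have D2 : inK 0 1 1 (d / c) by apply: inK_eq D1 _ _ _ _; ring.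
have detD : 0 * (d / c) - 1 * (1 : 'F_5) != 0 by rewrite mul0r mulr1 sub0r.
have D3 := inK_mul detD (det2 _ m0) D2 (inK_dilate m0).
have D4 : inK 0 m 1 (d / c) by apply: inK_eq D3 _ _ _ _; ring.
have detE : 0 * (d / c) - m * 1 != 0 by rewrite mul0r mulr1 sub0r oppr_eq0.
have := inK_mul detE (det1 (a / c)) D4 (inK_shift (a / c)).
by move/(inK_scale c0)/inK_eq; apply; rewrite /m; field.
Qed.

End PGL2_5.

Definition F5_points : seq (option 'F_5) :=
  [:: None; Some 0%R; Some 1%R; Some 2%R; Some 3%R; Some 4%R].

Lemma F5_all (P : pred (option 'F_5)) : all P F5_points -> forall z, P z.
Proof.
move=> /allP H z; apply: H; case: z => [[[|[|[|[|[|m]]]]] lt]|] //.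
Qed.

Definition label (z : option 'F_5) : nat := if z is Some x then x : nat else 5.
Definition unlabel (n : nat) : option 'F_5 := nth None (behead F5_points) n.

(* The five fixed-point-free involutions normalised by [PGL2 'F_5]: they form a
   synthematic total of the projective line. *)
Definition total : seq (seq nat) :=
  [:: [:: 1; 0; 4; 5; 2; 3]; [:: 3; 2; 1; 0; 5; 4]; [:: 5; 4; 3; 2; 1; 0];
      [:: 2; 5; 0; 4; 3; 1]; [:: 4; 3; 5; 1; 0; 2]].

Definition tau_fun (n : nat) (z : option 'F_5) : option 'F_5 :=
  unlabel (nth 0 (nth (iota 0 6) total n) (label z)).

Lemma tau_funK n : involutive (tau_fun n).
Proof.
move=> z; apply/eqP; move: z; apply: F5_all.
have [n5|n5] := ltnP n 5; last by rewrite /tau_fun nth_default //; vm_compute.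
by case: n n5 => [|[|[|[|[|n]]]]] // _; vm_compute.
Qed.

Definition tau n : {perm option 'F_5} := perm (can_inj (tau_funK n)).

(** These tables record how z+1, 2z and 1/z permute the five involutions by conjugation. *)
Definition tabT := [:: 1; 2; 3; 4; 0].
Definition tabM := [:: 3; 0; 2; 4; 1].
Definition tabJ := [:: 3; 4; 2; 0; 1].

Lemma tau_conj (g : {perm option 'F_5}) (phi : option 'F_5 -> option 'F_5) i j :
  g =1 phi -> all (fun z => phi (tau_fun i z) == tau_fun j (phi z)) F5_points ->
  (tau i ^ g)%g = tau j.
Proof.
move=> gE H; apply/permP=> z; rewrite -[z](permKV g) permJ !permE !gE.
exact/eqP/(F5_all H).
Qed.

Lemma tau_conj_tab (g : {perm option 'F_5}) phi tab : g =1 phi ->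
  all (fun i => all (fun z => phi (tau_fun i z) == tau_fun (nth 0 tab i) (phi z)) F5_points)
      (iota 0 5) ->
  forall i, i < 5 -> (tau i ^ g)%g = tau (nth 0 tab i).
Proof.
move=> gE /allP H i i5; apply: tau_conj gE (H i _).
by rewrite mem_iota.
Qed.

Lemma tau_inj (i j : 'I_5) : tau i = tau j -> i = j.
Proof.
move/permP/(_ (Some 0%R)); rewrite !permE => E; apply: val_inj; move: E.
by case: i => [[|[|[|[|[|i]]]]] //= _]; case: j => [[|[|[|[|[|j]]]]] //= _].
Qed.

(** A product of four of the involutions has 0 as its only fixed point, so a permutation
    centralising all five fixes 0; the other points are the images of 0 under the five involutions,
    hence fixed as well. *)
Lemma tau_cent (g : {perm option 'F_5}) : (forall i, i < 5 -> (tau i ^ g)%g = tau i) -> g = 1%g.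
Proof.
move=> gT; have gtau i z : i < 5 -> tau_fun i (g z) = g (tau_fun i z).
  by move=> i5; rewrite -!(permE (can_inj (tau_funK i))) -/(tau i) -{1}(gT i i5) permJ.
have fix0 z : tau_fun 2 (tau_fun 4 (tau_fun 1 (tau_fun 0 z))) == z -> z = Some 0%R.
  move=> zE; apply/eqP; move: zE; apply/implyP; move: z; apply: F5_all.
  by vm_compute.
have g0 : g (Some 0%R) = Some 0%R.
  by apply: fix0; rewrite !gtau // (_ : tau_fun 2 _ = Some 0%R).
apply/permP=> z; rewrite perm1; apply/eqP.
have : (z == Some 0%R) || has (fun i => z == tau_fun i (Some 0%R)) (iota 0 5).
  by move: z; apply: F5_all; vm_compute.
case/orP=> [/eqP->|/hasP[i]]; first by rewrite g0.
by rewrite mem_iota => i5 /eqP->; rewrite -gtau // g0.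
Qed.

Lemma PGL2_5_isog : PGL2 'F_5 \isog [set: 'S_5].
Proof.
have [gT gTP gTE] := @moebius_perm 'F_5 1%R 1%R 0%R 1%R isT.
have [gM gMP gME] := @moebius_perm 'F_5 2%R 0%R 0%R 1%R isT.
have [gJ gJP gJE] := @moebius_perm 'F_5 0%R 1%R 1%R 0%R isT.
have tauT := tau_conj_tab (tab := tabT) gTE isT.
have tauM := tau_conj_tab (tab := tabM) gME isT.
have tauJ := tau_conj_tab (tab := tabJ) gJE isT.
pose N : {set {perm option 'F_5}} := [set g | [forall i : 'I_5, exists j : 'I_5, (tau i ^ g)%g == tau j]].
have N_group : group_set N.
  apply/group_setP; split=> [|g g']; rewrite !inE.
    by apply/forallP=> i; apply/existsP; exists i; rewrite conjg1.
  move=> /forallP gN /forallP g'N; apply/forallP=> i.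
  have /existsP[j /eqP ij] := gN i; have /existsP[l /eqP jl] := g'N j.
  by apply/existsP; exists l; rewrite conjgM ij jl.
have tab_N g tab : (forall i, i < 5 -> (tau i ^ g)%g = tau (nth 0 tab i)) ->
    all (fun n => n < 5) tab -> g \in N.
  move=> gtab /all_nthP tab5; rewrite inE; apply/forallP=> i; apply/existsP.
  have ltab : nth 0 tab i < 5.
    by case: (ltnP i (size tab)) => h; [apply: tab5|rewrite nth_default].
  by exists (Ordinal ltab); rewrite gtab.
have PN : PGL2 'F_5 \subset Group N_group.
  apply: PGL2_5_sub; [exists gT|exists gM|exists gJ] => //=.
  - exact: tab_N tauT isT.
  - exact: tab_N tauM isT.
  exact: tab_N tauJ isT.
have [|||||f [finj fE]] := @action_morphism _ (PGL2_group 'F_5) _ 'I_5 conjg (fun i => tau i).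
- by move=> i j /tau_inj.
- exact: conjg1.
- exact: conjgM.
- move=> g i /(subsetP PN); rewrite inE => /forallP/(_ i)/existsP[j /eqP ij].
  by exists j.
- by move=> g _ H; apply: tau_cent => i i5; apply: (H (Ordinal i5)).
apply: (isog_perm finj).
have L5 : [set: 'I_5] = [set:: map (@inord 4) (iota 0 5)].
  apply/setP=> i; rewrite !in_set; apply/esym/mapP.
  by exists (i : nat); rewrite ?mem_iota ?inord_val /=.
have gens i : exists2 s, s \in f @* PGL2 'F_5 &
    acts_as (@inord 4) (mem (iota 0 5)) s (nth id [:: nth 0 tabT; nth 0 tabM; nth 0 tabJ] i).
  have acts g tab : g \in PGL2 'F_5 -> (forall i, i < 5 -> (tau i ^ g)%g = tau (nth 0 tab i)) ->
    all (fun n => n < 5) tab -> exists2 s, s \in f @* PGL2 'F_5 & acts_as (@inord 4) (mem (iota 0 5)) s (nth 0 tab).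
    move=> gP gtab /all_nthP tab5; exists (f g); first by rewrite mem_morphim.
    have ltab n : nth 0 tab n < 5.
      by case: (ltnP n (size tab)) => h; [apply: tab5|rewrite nth_default].
    split=> [n|t tn]; last by case: (tn t); rewrite ?mem_iota ?inord_val //=.
    rewrite !mem_iota /= => n5; split=> //; apply: tau_inj.
    by rewrite fE // !inordK // gtab.
  case: i => [|[|[|i]]].
  - exact: acts gTP tauT isT.
  - exact: acts gMP tauM isT.
  - exact: acts gJP tauJ isT.
  by exists 1%g; rewrite ?group1 //= nth_nil; apply: acts_as1.
(* On the five indices [T T J] is a 3-cycle and [M J] a transposition, where [T], [M], [J] are z+1,
   2z, 1/z. *)
rewrite L5; apply: (Sym_sub _ gens (w := [:: 0; 0; 2]) (cs := [::]) (w' := [:: 1; 2]) (cs' := [::]) (n := 5)).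
- by move=> m n; rewrite !mem_iota /= => m5 n5 /(congr1 val); rewrite /= !inordK.
- by vm_compute.
by vm_compute.
Qed.

(** * Single pieces, and the figure with six tiles *)

Lemma admissible_small k (F : {fset tile}) : 0 < k -> admissible k F ->
  #|` F| <= k * k.+1 -> is_piece k F.
Proof.
move=> k0 adm nF; have [R pR RF] : exists2 R, is_piece k R & (R `<=` F)%fset.
  elim: adm {nF} => [R pR|{}F R _ [R' pR' R'F] _ _]; first by exists R.
  by exists R' => //; apply: (fsubset_trans R'F); apply: fsubsetUr.
suff <- : R = F by [].
by apply/eqP; rewrite eqEfcard RF (piece_card k0 pR).
Qed.

(* Makes the turns [a] and [b] act as z |-> 1 / (2 z + 1) and z |-> z / 2. *)
Definition cell (z : option 'F_5) : nat * nat :=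
  if z is Some x then nth (0, 0) [:: (0, 0); (0, 1); (1, 1); (0, 2); (1, 2)] x else (1, 0).

Lemma cell_box z : cell z \in box 2.
Proof. by move: z; apply: F5_all. Qed.

Lemma cell_inj : injective cell.
Proof.
move=> z w /eqP zw; apply/eqP; move: zw; apply/implyP.
move: w; apply: F5_all; move: z; apply: F5_all; by vm_compute.
Qed.

(** Each inclusion is read off a group: [H], the tile permutations matched by some element of
    [PGL2], contains the two turns; [K], the permutations of the line matched by some element of
    [G], contains generators of [PGL2]. *)
Lemma puzzle_group_6 (F : {fset tile}) : is_piece 2 F ->
  exists phi : F -> option 'F_5, bijective phi /\
    forall s : {perm F}, s \in puzzle_group 2 F <->
      exists2 g : {perm option 'F_5}, g \in PGL2 'F_5 & forall t : F, phi (s t) = g (phi t).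
Proof.
move=> pF; set G := puzzle_group 2 F.
have [e [c [a [b [inj _ eF [aG bG [aE _] [bE _]] ab]]]]] :=
  piece_frame_moves (isT : 0 < 2) pF (fsubset_refl F).
pose psi z := e (cell z).
have psi_inj : injective psi by move=> z w /(inj _ _ (cell_box z) (cell_box w))/cell_inj.
have [phi psiK phiK] : bijective psi.
  by apply: (inj_card_bij psi_inj); rewrite -cardfE (piece_card _ pF) // card_option card_Fp.
exists phi; split; first by exists psi.
pose conj (s : {perm F}) (g : {perm option 'F_5}) := [forall z, s (psi z) == psi (g z)].
have conj1 : conj 1%g 1%g by apply/forallP=> z; rewrite !perm1.
have conjM s g s' g' : conj s g -> conj s' g' -> conj (s * s')%g (g * g')%g.
  move=> /forallP sg /forallP sg'; apply/forallP=> z.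
  by rewrite !permM (eqP (sg z)) (eqP (sg' _)).
have [ga gaP gaE] := @moebius_perm 'F_5 0%R 1%R 2%R 1%R isT.
have [gb gbP gbE] := @moebius_perm 'F_5 1%R 0%R 0%R 2%R isT.
have conj_a : conj a ga.
  apply/forallP=> z; rewrite /psi (aE _ (cell_box z)).2 gaE; apply/eqP; congr e; apply/eqP.
  by move: z; apply: F5_all; vm_compute.
have conj_b : conj b gb.
  apply/forallP=> z; rewrite /psi (bE _ (cell_box z)).2 gbE; apply/eqP; congr e; apply/eqP.
  by move: z; apply: F5_all; vm_compute.
pose H : {set {perm F}} := [set s | [exists g in PGL2 'F_5, conj s g]].
have H_group : group_set H.
  apply/group_setP; split=> [|s s']; rewrite !inE; first by apply/exists_inP; exists 1%g; rewrite ?group1.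
  move=> /exists_inP[g gP sg] /exists_inP[g' gP' sg']; apply/exists_inP.
  by exists (g * g')%g; rewrite ?groupM //; apply: conjM.
have GH : G \subset Group H_group.
  apply: puzzle_group_sub => p s pF' sE; rewrite inE; apply/exists_inP.
  by have [->|->] := ab p s pF' sE; [exists ga|exists gb].
pose K : {set {perm option 'F_5}} := [set g | [exists s in G, conj s g]].
have K_group : group_set K.
  apply/group_setP; split=> [|g g']; rewrite !inE; first by apply/exists_inP; exists 1%g; rewrite ?group1.
  move=> /exists_inP[s sG sg] /exists_inP[s' sG' sg']; apply/exists_inP.
  by exists (s * s')%g; rewrite ?groupM //; apply: conjM.
have gaK : ga \in Group K_group by rewrite inE; apply/exists_inP; exists a.
have gbK : gb \in Group K_group by rewrite inE; apply/exists_inP; exists b.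
have PK : PGL2 'F_5 \subset Group K_group.
  apply: PGL2_5_sub.
  (* Words in the two turns for z+1, 2z and 1/z; the second one works since 1/8 = 2 modulo 5. *)
  - exists (ga * ga * ga * gb * ga * ga)%g; first by rewrite !groupM.
    move=> z; rewrite !permM !(gaE, gbE); apply/eqP; move: z; apply: F5_all; by vm_compute.
  - exists (gb * gb * gb)%g; first by rewrite !groupM.
    move=> z; rewrite !permM !gbE; apply/eqP; move: z; apply: F5_all; by vm_compute.
  exists (ga * ga * gb * gb * gb * ga * gb * ga)%g; first by rewrite !groupM.
  move=> z; rewrite !permM !(gaE, gbE); apply/eqP; move: z; apply: F5_all; by vm_compute.
move=> s; split=> [/(subsetP GH)|[g /(subsetP PK)]]; rewrite inE => /exists_inP[x xP].
  by move=> /forallP sx; exists x => // t; rewrite -{1}[t]phiK (eqP (sx _)) psiK.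
move=> /forallP xg sg; suff -> : s = x by [].
by apply/permP=> t; apply: (can_inj phiK); rewrite sg -[t in RHS]phiK (eqP (xg _)) psiK.
Qed.

(** * The figure with twelve tiles *)

(* Entry [i, j] lists, as a fixed-point-free involution, the syntheme of the
   even cells shared by the totals attached to the [i]-th and [j]-th odd cells:
   this is the outer automorphism of [S_6]. *)
Definition shared_synthemes : seq (seq (seq nat)) :=
  [:: [:: [:: 0; 0; 0; 0; 0; 0]; [:: 3; 5; 4; 0; 2; 1]; [:: 2; 4; 0; 5; 1; 3];
          [:: 5; 2; 1; 4; 3; 0]; [:: 1; 0; 3; 2; 5; 4]; [:: 4; 3; 5; 1; 0; 2]];
      [:: [:: 3; 5; 4; 0; 2; 1]; [:: 0; 0; 0; 0; 0; 0]; [:: 1; 0; 5; 4; 3; 2];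
          [:: 2; 3; 0; 1; 5; 4]; [:: 4; 2; 1; 5; 0; 3]; [:: 5; 4; 3; 2; 1; 0]];
      [:: [:: 2; 4; 0; 5; 1; 3]; [:: 1; 0; 5; 4; 3; 2]; [:: 0; 0; 0; 0; 0; 0];
          [:: 4; 5; 3; 2; 0; 1]; [:: 5; 3; 4; 1; 2; 0]; [:: 3; 2; 1; 0; 5; 4]];
      [:: [:: 5; 2; 1; 4; 3; 0]; [:: 2; 3; 0; 1; 5; 4]; [:: 4; 5; 3; 2; 0; 1];
          [:: 0; 0; 0; 0; 0; 0]; [:: 3; 4; 5; 0; 1; 2]; [:: 1; 0; 4; 5; 2; 3]];
      [:: [:: 1; 0; 3; 2; 5; 4]; [:: 4; 2; 1; 5; 0; 3]; [:: 5; 3; 4; 1; 2; 0];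
          [:: 3; 4; 5; 0; 1; 2]; [:: 0; 0; 0; 0; 0; 0]; [:: 2; 5; 0; 4; 3; 1]];
      [:: [:: 4; 3; 5; 1; 0; 2]; [:: 5; 4; 3; 2; 1; 0]; [:: 3; 2; 1; 0; 5; 4];
          [:: 1; 0; 4; 5; 2; 3]; [:: 2; 5; 0; 4; 3; 1]; [:: 0; 0; 0; 0; 0; 0]]].

Local Notation L := (cbox 3).

Definition syn (w w' x : nat * nat) : nat * nat :=
  nth (0, 0) (L false)
    (nth 0 (nth [::] (nth [::] shared_synthemes (index w (L true))) (index w' (L true)))
       (index x (L false))).

Lemma syn_rotn j w w' x : j < 2 -> w \in L true -> w' \in L true -> x \in L false -> w != w' ->
  rotn 3 (0, j) (syn w w' x) =
  syn (rotn 3 (0, j) w) (rotn 3 (0, j) w') (rotn 3 (0, j) x).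
Proof.
move=> j2 wL w'L xL ww'; apply/eqP.
have : all (fun j => all (fun w => all (fun w' => all (fun x => (w != w') ==>
  (rotn 3 (0, j) (syn w w' x) == syn (rotn 3 (0, j) w) (rotn 3 (0, j) w') (rotn 3 (0, j) x)))
  (L false)) (L true)) (L true)) (iota 0 2) by vm_compute.
move/allP/(_ j); rewrite mem_iota j2 => /(_ isT)/allP/(_ _ wL)/allP/(_ _ w'L)/allP/(_ _ xL).
by rewrite ww'.
Qed.

(** Different pairs of totals share different synthemes, so a syntheme determines its pair of odd
    cells. *)
Lemma syn_eq w w' v v' : w \in L true -> w' \in L true -> v \in L true -> v' \in L true ->
  w != w' -> v != v' -> {in L false, forall x, syn w w' x = syn v v' x} -> (v == w) || (v == w').
Proof.
move=> wL w'L vL v'L ww' vv' E.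
have : all (fun w => all (fun w' => all (fun v => all (fun v' =>
  [&& w != w', v != v' & all (fun x => syn w w' x == syn v v' x) (L false)] ==>
  ((v == w) || (v == w'))) (L true)) (L true)) (L true)) (L true) by vm_compute.
move/allP/(_ _ wL)/allP/(_ _ w'L)/allP/(_ _ vL)/allP/(_ _ v'L)/implyP; apply.
by rewrite ww' vv'; apply/allP=> x /E ->.
Qed.

Lemma syn_even w w' x : syn w w' x \in L false.
Proof.
rewrite /syn; set n := nth 0 _ _; have [nL|nL] := ltnP n (size (L false)).
  exact: mem_nth.
by rewrite nth_default //; vm_compute.
Qed.

Lemma two_others w : w \in L true -> exists w' w'',
  [/\ w' \in L true, w'' \in L true, w != w', w != w'' & w' != w''].
Proof.
move=> wL; have : all (fun w => has (fun w' => has (fun w'' =>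
  [&& w != w', w != w'' & w' != w'']) (L true)) (L true)) (L true) by vm_compute.
move/allP/(_ _ wL)/hasP=> [w' w'L /hasP[w'' w''L /and3P[*]]].
by exists w', w''.
Qed.

Lemma rotn_cbox j d u : j < 2 -> u \in L d -> rotn 3 (0, j) u \in L d.
Proof.
move=> j2 uL; have : all (fun j => all (fun d => all (fun u => rotn 3 (0, j) u \in L d) (L d))
   [:: true; false]) (iota 0 2) by vm_compute.
move/allP/(_ j); rewrite mem_iota j2 => /(_ isT)/allP/(_ d).
by case: d uL => uL /(_ isT)/allP; apply.
Qed.

Lemma cbox_box d u : u \in L d -> u \in box 3.
Proof. by rewrite mem_filter => /andP[]. Qed.

Lemma size_cbox3 d : size (L d) = 6.
Proof. by case: d. Qed.

Lemma cbox_uniq d : uniq (L d).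
Proof. by case: d. Qed.

Definition cell_set (F : {fset tile}) (e : nat * nat -> F) (d : bool) : {set F} :=
  [set:: map e (L d)].

Lemma cell_setE (F : {fset tile}) (e : nat * nat -> F) d :
  cell_set e d = [set:: map e (L d)].
Proof. by []. Qed.

(* Otherwise [done] tries to compute with these explicit lists. *)
Local Opaque cbox box rotn syn cell_set.

Section TwelveTiles.
Variables (F : {fset tile}) (e : nat * nat -> F) (a b : {perm F}).
Local Notation G := (puzzle_group 3 F).
Hypothesis e_inj : {in box 3 &, injective e}.
Hypothesis e_surj : forall t, exists2 u, u \in box 3 & t = e u.
Hypotheses (aG : a \in G) (bG : b \in G).
Hypothesis aE : acts_as e (mem (box 3)) a (rotn 3 (0, 0)).
Hypothesis bE : acts_as e (mem (box 3)) b (rotn 3 (0, 1)).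
Hypothesis ab : forall p (s : {perm F}), (rect p 3 3 `<=` F)%fset ->
  (forall t : F, val (s t) = Defs.rot 3 p (val t)) -> s = a \/ s = b.

Local Notation X := (cell_set e).

Lemma mem_X d t : reflect (exists2 u, u \in L d & t = e u) (t \in X d).
Proof. by rewrite cell_setE in_set; apply: mapP. Qed.

Lemma eX d u : u \in L d -> e u \in X d.
Proof. by move=> uL; apply/mem_X; exists u. Qed.

Lemma eE d u v : u \in L d -> v \in L d -> e u = e v -> u = v.
Proof. by move=> uL vL; apply: e_inj; apply: cbox_box; [exact: uL|exact: vL]. Qed.

Lemma puzzle_group_ab (H : {group {perm F}}) : a \in H -> b \in H -> G \subset H.
Proof. by move=> aH bH; apply: puzzle_group_sub => p s pF sE; have [->|->] := ab pF sE. Qed.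

Lemma step_stable j d s : j < 2 -> acts_as e (mem (box 3)) s (rotn 3 (0, j)) ->
  s \in 'N(X d | 'P)%g.
Proof.
move=> j2 [sE _]; rewrite !inE; apply/subsetP=> t /mem_X[u uL ->]; rewrite inE /= apermE.
by rewrite (sE u (cbox_box uL)).2; apply/eX/rotn_cbox.
Qed.

Lemma G_stable d : G \subset 'N(X d | 'P)%g.
Proof. by apply: puzzle_group_ab; [exact: (step_stable _ _ aE)|exact: (step_stable _ _ bE)]. Qed.

Lemma G_X d g t : g \in G -> (g t \in X d) = (t \in X d).
Proof. by move=> /(subsetP (G_stable d))/astabsP; apply. Qed.

Lemma restr_acts j d s : j < 2 -> acts_as e (mem (box 3)) s (rotn 3 (0, j)) ->
  acts_as e (mem (L d)) (restr_perm (X d) s) (rotn 3 (0, j)).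
Proof.
move=> j2 sE; split=> [u uL|t tn].
  split; first exact: rotn_cbox.
  by rewrite restr_permE ?(step_stable _ j2 sE) ?eX //; apply: (sE.1 u (cbox_box uL)).2.
apply: (out_perm (restr_perm_on _ _)); apply/negP=> /mem_X[u uL te]; exact: (tn u).
Qed.

(** On the six cells of its class the word has cycle type 3+2+1: its square is a 3-cycle and its
    cube a transposition. *)
Definition word3 (d : bool) : seq nat := if d then [:: 0; 0; 1] else [:: 0; 1; 1].

Lemma words3_spread d :
  spreads (frame_gens 3) (L d) (power_word (L d) (frame_gens 3) (word3 d) [:: 2]) 6 (L d) &&
  swaps (L d) (power_word (L d) (frame_gens 3) (word3 d) [:: 3]).
Proof. by case: d; vm_compute. Qed.

Lemma restr_full d : restr_perm (X d) @* G = perm.Sym (X d).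
Proof.
apply/eqP; rewrite eqEsubset; apply/andP; split.
  by apply/subsetP=> _ /morphimP[g _ _ ->]; rewrite inE restr_perm_on.
have gens i : exists2 s, s \in restr_perm (X d) @* G &
    acts_as e (mem (L d)) s (nth id (frame_gens 3) i).
  have mem_r s : s \in G -> restr_perm (X d) s \in restr_perm (X d) @* G.
    by move=> sG; rewrite mem_morphim // (subsetP (G_stable d)).
  case: i => [|[|i]].
  - by exists (restr_perm (X d) a); [exact: mem_r|exact: restr_acts aE].
  - by exists (restr_perm (X d) b); [exact: mem_r|exact: restr_acts bE].
  by exists 1%g; rewrite ?group1 //= nth_nil; apply: acts_as1.
have /andP[sp sw] := words3_spread d.
by rewrite cell_setE; apply: (Sym_sub _ gens sp sw) => u v; apply: eE.
Qed.

Lemma card_X d : #|X d| = 6.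
Proof.
rewrite cell_setE cardsE (card_uniqP _) ?size_map ?size_cbox3 // map_inj_in_uniq ?cbox_uniq //.
by move=> u v; apply: eE.
Qed.

Lemma X_cover t : (t \in X true) || (t \in X false).
Proof.
have [u uk ->] := e_surj t; have [ou|ou] := boolP (odd (u.1 + u.2)).
  by rewrite eX // mem_filter uk ou.
by rewrite orbC eX // mem_filter uk (negPf ou).
Qed.

Lemma X_disjoint t : t \in X true -> t \in X false -> False.
Proof.
move=> /mem_X[u uL ->] /mem_X[v vL] /e_inj; rewrite (cbox_box uL) (cbox_box vL) => /(_ isT isT) uv.
by move: uL vL; rewrite uv !mem_filter /=; case: odd.
Qed.

(** The restriction to a class is the full symmetric group and so contains the transposition taking
    [t] to any other tile of the class. *)
Lemma orbit_X d t : t \in X d -> orbit 'P G t = X d.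
Proof.
move=> tX; apply/setP=> t'; apply/orbitP/idP => [[g gG <-]|t'X].
  by rewrite /= apermE G_X.
have : tperm t t' \in restr_perm (X d) @* G.
  rewrite restr_full inE; apply/subsetP=> s; rewrite inE.
  by case: tpermP => [->|->|]; rewrite ?eqxx.
case/morphimP=> g gN gG E; exists g => //; rewrite /= apermE.
by rewrite -(restr_permE gN tX) -E tpermL.
Qed.

Lemma orbits_X : [set orbit 'P G t | t in [set: F]] = [set X true; X false].
Proof.
have X0 d : exists t, t \in X d.
  by have /card_gt0P : 0 < #|X d| by rewrite card_X.
apply/setP=> O; rewrite in_set2; apply/imsetP/orP => [[t _ ->]|].
  by have /orP[/orbit_X->|/orbit_X->] := X_cover t; [left|right].
by case=> /eqP->; [have [t tX] := X0 true|have [t tX] := X0 false];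
  exists t; rewrite ?(orbit_X tX).
Qed.

Let coord t := nth (0, 0) (box 3) (index t (map e (box 3))).

Lemma coordK u : u \in box 3 -> coord (e u) = u.
Proof.
move=> uk; have [v vk E] : exists2 v, v \in box 3 & e u = e v by exists u.
rewrite /coord; apply: e_inj => //.
  by rewrite mem_nth // -(size_map e) index_mem map_f.
by rewrite -(nth_map _ (e u)) ?nth_index ?map_f // -(size_map e) index_mem map_f.
Qed.

Let Syn t t' x := e (syn (coord t) (coord t') (coord x)).

(** The permutations that preserve both classes and respect [Syn] form a group, and the two turns
    belong to it by the finite check [syn_rotn]. *)
Lemma Syn_equivariant g : g \in G -> {in X true &, forall t t', {in X false, forall x, t != t' ->
  g (Syn t t' x) = Syn (g t) (g t') (g x)}}.
Proof.
pose N : {set {perm F}} := [set g in 'N(X true | 'P) :&: 'N(X false | 'P) |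
  [forall t in X true, forall t' in X true, forall x in X false, (t != t') ==>
    (g (Syn t t' x) == Syn (g t) (g t') (g x))]].
have NP (h : {perm F}) : reflect ([/\ forall t, (h t \in X true) = (t \in X true),
      forall t, (h t \in X false) = (t \in X false) &
      forall t t' x, t \in X true -> t' \in X true -> x \in X false -> t != t' ->
      h (Syn t t' x) = Syn (h t) (h t') (h x)]) (h \in N).
  rewrite in_set in_setI; apply: (iffP andP) => [[/andP[/astabsP h1 /astabsP h0] hS]|[h1 h0 hS]].
    split=> // t t' x tX t'X xX tt'; apply/eqP.
    move: hS => /forall_inP/(_ t tX)/forall_inP/(_ t' t'X)/forall_inP/(_ x xX)/implyP; exact.
  split; first by apply/andP; split; apply/astabsP.
  apply/forall_inP=> t tX; apply/forall_inP=> t' t'X; apply/forall_inP=> x xX; apply/implyP=> tt'.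
  by apply/eqP; apply: hS.
have N_group : group_set N.
  apply/group_setP; split=> [|h h' /NP[h1 h0 hS] /NP[h1' h0' hS']]; apply/NP.
    by split=> [t|t|t t' x _ _ _ _]; rewrite !perm1.
  split=> [t|t|t t' x tX t'X xX tt']; rewrite !permM ?h1' ?h0' //.
  by rewrite hS // hS' ?h1 ?h0 // (inj_eq perm_inj).
have stepN j (s : {perm F}) : j < 2 -> acts_as e (mem (box 3)) s (rotn 3 (0, j)) -> s \in N.
  move=> j2 sE; apply/NP; have /astabsP s1 := step_stable true j2 sE.
  have /astabsP s0 := step_stable false j2 sE; split=> // t t' x.
  move=> /mem_X[u uL ->] /mem_X[u' u'L ->] /mem_X[v vL ->] uu'.
  have sEE w d : w \in L d -> s (e w) = e (rotn 3 (0, j) w) by move=> /cbox_box wk; have [] := sE.1 w wk.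
  have cE w d : w \in L d -> coord (e w) = w by move=> /cbox_box; apply: coordK.
  rewrite /Syn (sEE u _ uL) (sEE u' _ u'L) (sEE v _ vL) (cE u _ uL) (cE u' _ u'L) (cE v _ vL).
  rewrite (cE _ true) ?rotn_cbox // (cE _ true) ?rotn_cbox // (cE _ false) ?rotn_cbox //.
  rewrite (sEE _ false) ?syn_even // syn_rotn //.
  by apply: contra_neq uu' => ->.
have /subsetP GN : G \subset Group N_group.
  by apply: puzzle_group_ab; [exact: stepN aE|exact: stepN bE].
by move=> /GN/NP[_ _ gS] t t' tX t'X x xX; apply: gS.
Qed.

(** If [g] fixes all even tiles it preserves every syntheme, hence every pair of odd tiles as a set;
    a tile [t] moved by [g] would then be sent to each of two different partners. *)
Lemma even_faithful g : g \in G -> {in X false, forall x, g x = x} -> g = 1%g.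
Proof.
move=> gG g0; apply/permP=> t; rewrite perm1.
have /orP[tX|/g0//] := X_cover t.
have near t' : t' \in X true -> t != t' -> (g t == t) || (g t == t').
  move=> t'X tt'.
  have [[v vL gv] [v' v'L gv']] :
      (exists2 v, v \in L true & g t = e v) /\ (exists2 v', v' \in L true & g t' = e v').
    by split; apply/mem_X; rewrite G_X.
  have [[w wL tw] [w' w'L tw']] :
      (exists2 v, v \in L true & t = e v) /\ (exists2 v', v' \in L true & t' = e v').
    by split; apply/mem_X.
  have cE u d : u \in L d -> coord (e u) = u by move=> /cbox_box; apply: coordK.
  have : (v == w) || (v == w').
    apply: (@syn_eq w w' v v') => // [||x xL].
    - by apply: contra_neq tt' => ww'; rewrite tw tw' ww'.
    - have : g t != g t' by rewrite (inj_eq perm_inj).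
      by apply: contra_neq => vv'; rewrite gv gv' vv'.
    have := Syn_equivariant gG tX t'X (eX xL) tt'.
    rewrite g0; last by rewrite /Syn eX ?syn_even.
    rewrite (g0 _ (eX xL)) /Syn gv gv' tw tw' (cE _ _ vL) (cE _ _ v'L) (cE _ _ wL) (cE _ _ w'L).
    rewrite (cE _ _ xL); apply: (@eE false); exact: syn_even.
  by rewrite gv tw tw' => /orP[]/eqP->; rewrite eqxx ?orbT.
have [w wL tw] := mem_X _ _ tX.
have [w' [w'' [w'L w''L ww' ww'' w'w'']]] := two_others wL.
have ne u u' : u \in L true -> u' \in L true -> u != u' -> e u != e u'.
  by move=> uL u'L; apply: contra_neq; apply: (@eE true).
apply/eqP; apply: contraT => gt.
have := near _ (eX w'L); rewrite {1}tw (ne w w') // (negPf gt) => /(_ isT)/eqP gw'.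
have := near _ (eX w''L); rewrite {1}tw (ne w w'') // (negPf gt) => /(_ isT)/eqP gw''.
by have := ne w' w'' w'L w''L w'w''; rewrite -gw' -gw'' eqxx.
Qed.

(** The isomorphism is the action on the six even cells: injective by [even_faithful], onto by the
    words used for the restrictions. *)
Lemma isog_S6 : G \isog [set: 'S_6].
Proof.
pose h (i : 'I_6) := e (nth (0, 0) (L false) i).
have nthL (i : 'I_6) : nth (0, 0) (L false) i \in L false by rewrite mem_nth ?size_cbox3.
have h_inj : injective h.
  move=> i j /(eE (nthL i) (nthL j))/eqP.
  by rewrite nth_uniq ?size_cbox3 ?cbox_uniq // => /eqP/val_inj.
pose idx u : 'I_6 := inord (index u (L false)).
have idxK u : u \in L false -> h (idx u) = e u.
  by move=> uL; rewrite /h inordK ?nth_index // -(size_cbox3 false) index_mem.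
have [||||f [finj fE]] := @action_morphism _ G F 'I_6 (fun t g => g t) h h_inj.
- by move=> t; rewrite perm1.
- by move=> t g g'; rewrite permM.
- move=> g i gG; have : g (h i) \in X false by rewrite G_X // eX.
  by case/mem_X=> u uL ->; exists (idx u); rewrite idxK.
- move=> g gG gh; apply: even_faithful => // _ /mem_X[u uL ->].
  by rewrite -idxK.
apply: (isog_perm finj).
have -> : [set: 'I_6] = [set:: map idx (L false)].
  apply/setP=> i; rewrite !in_set; apply/esym/mapP; exists (nth (0, 0) (L false) i) => //.
  by rewrite /idx index_uniq ?cbox_uniq ?size_cbox3 // inord_val.
have gens i : exists2 s, s \in f @* G & acts_as idx (mem (L false)) s (nth id (frame_gens 3) i).
  have acts j s : j < 2 -> s \in G -> acts_as e (mem (box 3)) s (rotn 3 (0, j)) ->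
    exists2 s', s' \in f @* G & acts_as idx (mem (L false)) s' (rotn 3 (0, j)).
    move=> j2 sG [sE _]; exists (f s); first exact: mem_morphim.
    split=> [u uL|l tn].
      have rL : rotn 3 (0, j) u \in L false by apply: rotn_cbox.
      split=> //; apply: h_inj; rewrite fE // !idxK //.
      by have [] := sE u (cbox_box uL).
    case: (tn (nth (0, 0) (L false) l)) => //.
    by rewrite /idx index_uniq ?cbox_uniq ?size_cbox3 // inord_val.
  case: i => [|[|i]]; [exact: acts aG aE|exact: acts bG bE|].
  by exists 1%g; rewrite ?group1 //= nth_nil; apply: acts_as1.
have /andP[sp sw] := words3_spread false.
apply: (Sym_sub _ gens sp sw) => u v uL vL /(congr1 h).
by rewrite (idxK u uL) (idxK v vL); apply: eE uL vL.
Qed.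

End TwelveTiles.

Lemma puzzle_group_12 (F : {fset tile}) : is_piece 3 F ->
  let G := puzzle_group 3 F in
  G \isog [set: 'S_6] /\
  (let orbits := [set orbit 'P G t | t in [set: F]] in
   #|orbits| = 2 /\
   forall O : {set F}, O \in orbits -> #|O| = 6 /\ restr_perm O @* G = perm.Sym O).
Proof.
move=> pF G.
have [e [c [a [b [inj _ eF [aG bG aE bE] ab]]]]] :=
  piece_frame_moves (isT : 0 < 3) pF (fsubset_refl F).
have surj t : exists2 u, u \in box 3 & t = e u by apply/eF/fsvalP.
split; first exact: (isog_S6 inj surj aG bG aE bE ab).
rewrite /G (orbits_X inj surj aG bG aE bE ab); split.
  rewrite cards2 (_ : _ != _) //; apply/eqP=> E.
  have [t tX] : exists t, t \in cell_set e true.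
    by apply/card_gt0P; rewrite (card_X inj).
  by apply: (X_disjoint inj tX); rewrite -E.
move=> O; rewrite in_set2 => /orP[]/eqP->;
  by rewrite (card_X inj) (restr_full inj aG bG aE bE ab).
Qed.

Local Open Scope group_scope.
Unset Implicit Arguments.

Theorem theorem1 (k : nat) (F : {fset tile}) :
  (1 < k)%N -> admissible k F ->
  let n := #|` F| in
  let G := puzzle_group k F in
  [/\ ~~ odd k -> n <> 6 ->
        (k = 0 %[mod 4] -> G = 'Alt_(F : finType) :> {set {perm F}}) /\
        (k = 2 %[mod 4] -> G = 'Sym_(F : finType) :> {set {perm F}}),
      odd k -> n <> 12 ->
        (k = 1 %[mod 8] \/ k = 7 %[mod 8] ->
           AltOn (black F) \x AltOn (white F) = G) /\
        (k = 3 %[mod 8] \/ k = 5 %[mod 8] ->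
           G = EvenProd (black F) (white F) :> {set {perm F}}),
      n = 6 ->
        (exists phi : F -> option 'F_5, bijective phi /\
           forall s : {perm F}, s \in G <->
             exists2 g : {perm option 'F_5}, g \in PGL2 'F_5 &
               forall t : F, phi (s t) = g (phi t)) /\
        PGL2 'F_5 \isog [set: 'S_5]
    & k = 3 -> n = 12 ->
        G \isog [set: 'S_6] /\
        (let orbits := [set orbit 'P G t | t in [set: F]] in
         #|orbits| = 2 /\
         forall O : {set F}, O \in orbits ->
           #|O| = 6 /\ restr_perm O @* G = perm.Sym O)].
Proof.
move=> k1 adm n G; have k0 := ltnW k1; split=> [ke n6|ko n12|n6|k3 n12].
- apply: puzzle_group_even => // k4 nk; apply: n6; rewrite /n nk.
  by have -> : k = 2 by move: k4 k1 ke; clear; lia.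
- have nF : (k < 4)%N -> #|` F| <> (k * k.+1)%N.
    move=> k4 nk; apply: n12; rewrite /n nk.
    by have -> : k = 3 by move: k4 k1 ko; clear; lia.
  by split=> k8; [apply: puzzle_group_17|apply: puzzle_group_35].
(* As [k] > 1, six tiles are at most the k(k+1) tiles of a piece, so the figure is a piece; then
   k(k+1) = 6 forces k = 2. *)
- have pF : is_piece k F.
    apply: admissible_small => //; rewrite -/n n6.
    by move: k1; clear; nia.
  have k2 : k = 2.
    by have := piece_card k0 pF; rewrite -/n n6; move: k1; clear; nia.
  by rewrite /G; subst k; split; [apply: puzzle_group_6|apply: PGL2_5_isog].
have pF : is_piece k F by apply: admissible_small => //; rewrite -/n n12 k3.
by rewrite /G; subst k; apply: puzzle_group_12.
Qed.
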